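(* For every integer $d\geq 2$ there exist $\varepsilon=\varepsilon(d)>0$ and $\eta=\eta(d)>0$ such that every distance-regular graph $X$ of diameter $d$ and degree $k$ satisfies at least one of: (1) there is $0\le i\le d-1$ with $b_i\geq\varepsilon k$ and $c_{i+1}\geq\varepsilon k$; (2) the zero-weight spectral radius $\xi$ of $X$ satisfies $\xi\leq k(1-\eta)$. Moreover, one may take $\eta=\frac14 d^{-(1+\log_2 d)}$ and $\varepsilon=200^{-(d+1)}d^{-(d+1)(\log_2 d+3)}$.
   Context: A connected graph $X$ of diameter $d$ is distance-regular if there are integers $a_i,b_i,c_i$ ($0\le i\le d$) such that for all vertices $v,w$ with $\mathrm{dist}(v,w)=i$, $w$ has exactly $c_i$ neighbours at distance $i-1$, $a_i$ at distance $i$, $b_i$ at distance $i+1$ from $v$; $X$ is $k$-regular with $k=b_0$. For a $k$-regular graph with adjacency eigenvalues $k=\xi_1\ge\dots\ge\xi_n$, the zero-weight spectral radius is $\xi=\max\{|\xi_i|:2\le i\le n\}$. *)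

(* Defs.v *)
From HB Require Import structures.
From Stdlib Require Import Reals ZArith.
From mathcomp Require Import all_boot all_order all_algebra all_field.
Set Implicit Arguments. Unset Strict Implicit. Unset Printing Implicit Defensive.
Import Order.TTheory GRing.Theory Num.Theory.

(* A simple graph is a symmetric irreflexive relation [e] on a finType [T]. *)

Definition ball (T : finType) (e : rel T) (v : T) (n : nat) : {set T} :=
  iter n (fun S => S :|: [set w | [exists u in S, e u w]]) [set v].

(* Graph distance: least n with w in ball e v n (searched in 0 .. #|T|-1,
   which suffices for connected graphs). *)
Definition dist (T : finType) (e : rel T) (v w : T) : nat :=
  find (fun n => w \in ball e v n) (iota 0 #|T|).

Definition connected (T : finType) (e : rel T) : Prop :=
  forall v w : T, connect e v w.

Definition diameter (T : finType) (e : rel T) : nat :=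
  \max_(p : T * T) dist e p.1 p.2.

Definition distance_regular (T : finType) (e : rel T)
    (a b c : nat -> nat) : Prop :=
  forall v w : T,
    [/\ #|[set u | e w u && ((dist e v u).+1 == dist e v w)]| = c (dist e v w),
        #|[set u | e w u && (dist e v u == dist e v w)]| = a (dist e v w) &
        #|[set u | e w u && (dist e v u == (dist e v w).+1)]| = b (dist e v w)].

Local Open Scope ring_scope.

Definition adjmx (T : finType) (e : rel T) : 'M[algC]_#|T| :=
  \matrix_(i, j) (e (enum_val i) (enum_val j))%:R.

(* Eigenvalues with multiplicity: the roots of the (monic) characteristic
   polynomial, char_poly A = \prod_(z <- s) ('X - z). *)
Definition spectrum (T : finType) (e : rel T) : seq algC :=
  sval (closed_field_poly_normal (char_poly (adjmx e))).

(* Zero-weight spectral radius: sort the eigenvalues decreasingly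
   (they are real), drop the first (xi_1 = k), take the max modulus. *)
Definition zw_spectral_radius (T : finType) (e : rel T) : algC :=
  \big[Num.max/0%R]_(x <- behead (sort (fun x y : algC => (y <= x)%R) (spectrum e)))
     `|x|%R.

Local Close Scope ring_scope.

Definition int2Z (z : int) : Z :=
  match z with Posz n => Z.of_nat n | Negz n => Z.opp (Z.of_nat n.+1) end.
Definition rat2R (q : rat) : R :=
  Rdiv (IZR (int2Z (numq q))) (IZR (int2Z (denq q))).

(* x <= y for a real algebraic x : algC and y : R, via rational cuts. *)
Definition leCR (x : algC) (y : R) : Prop :=
  forall q : rat, (ratr q <= x :> algC)%R -> Rle (rat2R q) y.

Definition log2 (x : R) : R := Rdiv (ln x) (ln 2).

Definition eta_const (d : nat) : R :=
  Rmult (Rdiv 1 4) (Rpower (INR d) (Ropp (Rplus 1 (log2 (INR d))))).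

Definition eps_const (d : nat) : R :=
  Rmult (Rpower 200 (Ropp (INR d.+1)))
        (Rpower (INR d) (Ropp (Rmult (INR d.+1) (Rplus (log2 (INR d)) 3)))).

(* Main.v *)
(* Assume that no index [i] has both [b_i] and [c_(i+1)] comparable to [k], and let
   [s] be the first index at which [b_s] is small compared to [k]; then [c_s] is
   much smaller than [b_(s-1)], and [S_s] dominates the smaller spheres.

   Moving [y] away from [x] along a geodesic, a fixed point [z] can leave the ball
   of radius [j] around [y] only through one of at most [b_j] of the [b_t] possible
   steps. Hence for [d(x, y) = i] all but a fraction [b_j * sum_(r < i) 1 / b_r] of
   [S_j(x)] lies in the ball [B_j(y)]. Applied on both sides of the middle point of a
   geodesic of length [j + 1 <= s], whose end points have almost disjoint balls of
   radius [j], this bounds [k / b_j] by the sum of the [k / b_r] with [r <= j / 2],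
   up to a factor close to 2; iterating gives [sum_(r < s) k / b_r = O(d ^ log2 d)].
   A similar count of the points of [S_s] bounds [c_(s+1)] from below.

   Let [u] be the average of an eigenfunction over the spheres around a vertex. If the
   eigenvalue exceeds [k (1 - eta)], these bounds make [u] vary so little between [0]
   and [s], and between [s] and [d], that it keeps a constant sign; this is impossible
   for an eigenfunction orthogonal to the constants. Since all products
   [b_i c_(i+1)] are tiny compared to [k ^ 2], there is no eigenvalue below [- k / 2]
   either. *)

From HB Require Import structures.
From Stdlib Require Import Reals Lra.
From mathcomp Require Import all_boot all_order all_algebra all_field zify ring lra.
Require Import Defs.
Set Implicit Arguments. Unset Strict Implicit. Unset Printing Implicit Defensive.
Import Order.TTheory GRing.Theory Num.Theory.

(** * Graph distance *)

Section Distance.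
Variables (T : finType) (e : rel T).
Hypotheses (e_sym : symmetric e) (e_conn : connected e).

Local Notation dist := (dist e).
Local Notation ball := (ball e).

Lemma in_ballS v n w :
  (w \in ball v n.+1) = (w \in ball v n) || [exists u in ball v n, e u w].
Proof. by rewrite /Defs.ball /= in_setU inE. Qed.

Lemma ball0 v w : (w \in ball v 0) = (w == v).
Proof. by rewrite /Defs.ball /= inE. Qed.

Lemma sub_ball v m n : m <= n -> {subset ball v m <= ball v n}.
Proof.
move=> /subnK <-; elim: (n - m) => [|p IH] w // /IH H.
by rewrite addSn in_ballS H.
Qed.

Lemma path_in_ball v p : path e v p -> last v p \in ball v (size p).
Proof.
elim/last_ind: p => [|p x IH]; first by rewrite ball0.
rewrite rcons_path last_rcons size_rcons => /andP[/IH H ex].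
by rewrite in_ballS; apply/orP; right; apply/existsP; exists (last v p); rewrite H.
Qed.

(** A path without repeated vertices has fewer than [#|T|] edges, so the bounded search in [dist]
    succeeds. *)
Lemma in_some_ball v w : exists2 n, n < #|T| & w \in ball v n.
Proof.
have /connectP[p /shortenP[q pq uq _] ->] := e_conn v w.
exists (size q); last exact: path_in_ball.
by rewrite -[X in X <= _]/(size (v :: q)) -(card_uniqP uq) max_card.
Qed.

Lemma in_ballE v n w : (w \in ball v n) = (dist v w <= n).
Proof.
have [m m_lt m_in] := in_some_ball v w.
have has_m : has (fun n => w \in ball v n) (iota 0 #|T|).
  by apply/hasP; exists m; rewrite ?mem_iota.
have lt_d := has_m; rewrite has_find size_iota in lt_d.
apply/idP/idP => [w_in|].
  rewrite leqNgt; apply/negP => lt_n.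
  by have := before_find 0 lt_n; rewrite nth_iota ?(ltn_trans lt_n) // add0n w_in.
move=> /sub_ball; apply.
by have := nth_find 0 has_m; rewrite nth_iota.
Qed.

Lemma dist_eq0 v w : (dist v w == 0) = (v == w).
Proof. by rewrite -leqn0 -in_ballE ball0 eq_sym. Qed.

Lemma distxx v : dist v v = 0.
Proof. by apply/eqP; rewrite dist_eq0. Qed.

Lemma dist_edge v u w : e u w -> dist v w <= (dist v u).+1.
Proof.
move=> euw; rewrite -in_ballE in_ballS; apply/orP; right.
by apply/existsP; exists u; rewrite in_ballE leqnn.
Qed.

Lemma dist_pred v w n : dist v w = n.+1 -> exists2 u, e u w & dist v u = n.
Proof.
move=> dn; have : w \in ball v n.+1 by rewrite in_ballE dn.
rewrite in_ballS in_ballE dn ltnn /= => /existsP[u /andP[]].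
rewrite in_ballE => du euw; exists u => //.
by apply/eqP; rewrite eqn_leq du -ltnS -dn dist_edge.
Qed.

Lemma dist_triangle v u w : dist v w <= dist v u + dist u w.
Proof.
move En: (dist u w) => n; elim: n w En => [|n IH] w En.
  by move/eqP: En; rewrite dist_eq0 => /eqP->; rewrite addn0.
have [x exw dx] := dist_pred En.
by apply: leq_trans (dist_edge v exw) _; rewrite addnS ltnS IH.
Qed.

Lemma dist_edge1 u w : e u w -> dist u w <= 1.
Proof. by move=> /(dist_edge u); rewrite distxx. Qed.

Lemma dist_sym v w : dist v w = dist w v.
Proof.
suff le x y : dist x y <= dist y x by apply/eqP; rewrite eqn_leq !le.
move En: (dist y x) => n; elim: n x En => [|n IH] x En.
  by move/eqP: En; rewrite dist_eq0 => /eqP->; rewrite distxx.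
have [u eux du] := dist_pred En.
have := dist_triangle x u y; have := IH _ du.
by have : dist x u <= 1 by [apply: dist_edge1; rewrite e_sym]; lia.
Qed.

Lemma dist_edge_sym v u w : e u w -> dist v u <= (dist v w).+1.
Proof. by rewrite e_sym => /dist_edge. Qed.

Lemma dist_between v w i : i <= dist v w ->
  exists2 u, dist v u = i & dist u w = dist v w - i.
Proof.
move En: (dist v w - i) => n le_i.
elim: n i En le_i => [|n IH] i En le_i.
  by exists w; rewrite ?distxx //; lia.
have [u dvu duw] := IH i.+1 ltac:(lia) ltac:(lia).
have [x exu dvx] := dist_pred dvu; exists x => //.
have := dist_triangle v x w; have := dist_triangle x u w.
by have := dist_edge1 exu; lia.
Qed.

Lemma dist_le_diameter v w : dist v w <= diameter e.
Proof. by rewrite /diameter (leq_bigmax (v, w)). Qed.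

Lemma dist_diameter : 0 < diameter e -> exists v w, dist v w = diameter e.
Proof.
move=> d_gt0; case: (pickP (@predT (T * T))) => [p _|T0]; last first.
  by move: d_gt0; rewrite /diameter big_pred0.
have /card_gt0P/(bigop.eq_bigmax (fun p => dist p.1 p.2)) : exists p : T * T, p \in predT.
  by exists p.
by case=> -[v w] /= dE; exists v, w; rewrite -dE.
Qed.

Lemma exists_dist i : 0 < diameter e -> i <= diameter e ->
  exists v w, dist v w = i.
Proof.
by move=> /dist_diameter[v [w <-]] /dist_between[u <- _]; exists v, u.
Qed.

End Distance.

(** * Three-term recurrences *)

Section Recurrence.
Local Open Scope ring_scope.
Variable F : realFieldType.

(* For [i = 0] the term [u i.-1 - u i] vanishes, so no [u (-1)] is needed. *)
Lemma slow_decrease (n : nat) (u p q : nat -> F) (delta rho : F) :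
  0 <= delta -> (forall i, (i < n)%N -> 0 < p i /\ 0 <= q i <= rho) ->
  (forall i, (i < n)%N -> p i * (u i - u i.+1) = q i * (u i.-1 - u i) + delta * u i) ->
  0 <= u 0 -> (delta + rho) * (\sum_(r < n) (p r)^-1) <= 1 ->
  forall i, (i <= n)%N ->
    [/\ u 0 * (1 - (delta + rho) * \sum_(r < i) (p r)^-1) <= u i, u i <= u 0,
        0 <= u i.-1 - u i & u i.-1 - u i <= u 0].
Proof.
move=> d_ge pq rec u0 sum_le; elim=> [|i IH] i_lt.
  by rewrite big_ord0 mulr0 subr0 mulr1 subrr; split.
have [IH1 IH2 IH3 IH4] := IH (ltnW i_lt).
have [p_gt /andP[q_ge q_le]] := pq i i_lt.
have r_ge : 0 <= delta + rho by lra.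
have ps m : (m <= n)%N -> \sum_(r < m) (p r)^-1 <= \sum_(r < n) (p r)^-1.
  move=> mn; have -> : n = (m + (n - m))%N by rewrite subnKC.
  rewrite big_split_ord /= lerDl sumr_ge0 // => r _; rewrite invr_ge0 ltW //.
  by case: (pq (m + r)%N) => //; have := ltn_ord r; lia.
have s_ge0 m : (m <= n)%N -> 0 <= \sum_(r < m) (p r)^-1.
  move=> mn; rewrite sumr_ge0 // => r _; rewrite invr_ge0 ltW //.
  by case: (pq r) => //; have := ltn_ord r; lia.
have recE : u i - u i.+1 = (p i)^-1 * (q i * (u i.-1 - u i) + delta * u i).
  by rewrite -rec // mulKf // gt_eqF.
have pinv_ge : 0 <= (p i)^-1 by rewrite invr_ge0 ltW.
have ui_ge : 0 <= u i.
  apply: le_trans IH1; rewrite mulr_ge0 // subr_ge0 (le_trans _ sum_le) //.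
  by rewrite ler_wpM2l // ps // ltnW.
have D_ge : 0 <= u i - u i.+1 by rewrite recE mulr_ge0 // addr_ge0 // mulr_ge0.
(* The previous drop and [u i] are both at most [u 0], so this drop costs at most the fraction
   [(delta + rho) / p i] of [u 0]. *)
have D_le : u i - u i.+1 <= u 0 * ((delta + rho) * (p i)^-1).
  rewrite recE (_ : u 0 * _ = (p i)^-1 * ((delta + rho) * u 0)); last by ring.
  rewrite ler_wpM2l //; have := ler_pM q_ge IH3 q_le IH4.
  by have := ler_wpM2l d_ge IH2; lra.
have := ps _ i_lt; have := s_ge0 _ (ltnW i_lt); rewrite big_ord_recr /=.
move: (\sum_(r < i) _) (\sum_(r < n) _) IH1 sum_le => S S' IH1 sum_le S_ge S_le.
split.
- by move: IH1 D_le; nra.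
- lra.
- by [].
- apply: le_trans D_le _; rewrite -[X in _ <= X]mulr1 ler_wpM2l //.
  by apply: le_trans sum_le; rewrite ler_wpM2l //; lra.
Qed.

Section Tridiagonal.
Variables (D : nat) (u b c : nat -> F) (k theta : F).
Hypothesis rec : forall i, (i <= D)%N ->
  b i * (u i - u i.+1) = c i * (u i.-1 - u i) + (k - theta) * u i.
Hypotheses (bD : b D = 0) (c0 : c 0 = 0).

(** As long as [u] has not decreased, both terms on the right of the recurrence are nonpositive, so
    [u] does not decrease at the next step either. *)
Lemma positive_above_degree : k <= theta -> 0 < u 0 ->
  (forall i, (i < D)%N -> 0 < b i /\ 0 <= c i) ->
  forall i, (i <= D)%N -> 0 < u i.
Proof.
move=> k_le u0 bc i iD.
suff [] : 0 < u i /\ u i.-1 <= u i by [].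
elim: i iD => [|i IH] iD; first by [].
have [ui_gt ui_le] := IH (ltnW iD); have [b_gt c_ge] := bc i iD.
have H : u i <= u i.+1.
  rewrite -subr_le0 -(pmulr_rle0 _ b_gt) (rec (ltnW iD)).
  have h1 : c i * (u i.-1 - u i) <= 0 by rewrite mulr_ge0_le0 ?subr_le0.
  have h2 : (k - theta) * u i <= 0 by rewrite mulr_le0_ge0 ?subr_le0 // ltW.
  by lra.
by split=> //; apply: lt_le_trans H.
Qed.

(* The recurrence is symmetric under i |-> D - i, so the estimate that keeps
   [u] positive from 0 up to [s] also keeps it of one sign from [D] down to [s]. *)
Lemma positive_below_degree s rho1 rho2 : (s <= D)%N -> theta <= k -> 0 < u 0 ->
  (forall i, (i < s)%N -> 0 < b i /\ 0 <= c i <= rho1) ->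
  (k - theta + rho1) * (\sum_(r < s) (b r)^-1) < 1 ->
  (forall i, (s < i <= D)%N -> 0 < c i /\ 0 <= b i <= rho2) ->
  (k - theta + rho2) * (\sum_(r < D - s) (c (D - r)%N)^-1) < 1 ->
  forall i, (i <= D)%N -> 0 < u i.
Proof.
move=> sD le_k u0 bL sumL bR sumR.
have d_ge : 0 <= k - theta by rewrite subr_ge0.
have left i : (i <= s)%N -> 0 < u i.
  move=> i_s; have recL j : (j < s)%N -> b j * (u j - u j.+1) =
      c j * (u j.-1 - u j) + (k - theta) * u j by move=> js; apply: rec; lia.
  have [H _ _ _] := slow_decrease d_ge bL recL (ltW u0) (ltW sumL) i_s.
  apply: lt_le_trans H; rewrite mulr_gt0 // subr_gt0; apply: (le_lt_trans _ sumL).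
  (* Only an index below [s] shows that [rho1] is nonnegative; for [s = 0] the sums are empty. *)
  have [r0|r_gt] := leP (k - theta + rho1) 0.
    case: s i_s bL sumL recL {sD bR sumR} => [|s] i_s bL sumL recL.
      by move: i_s; rewrite leqn0 => /eqP->; rewrite !big_ord0.
    have [_ /andP[q1 q2]] := bL 0%N isT.
    have -> : k - theta + rho1 = 0 by apply/eqP; rewrite eq_le r0 addr_ge0 // (le_trans q1).
    by rewrite !mul0r.
  rewrite ler_pM2l // -(subnKC i_s) big_split_ord /= lerDl sumr_ge0 // => r _.
  by rewrite invr_ge0 ltW //; case: (bL (i + r)%N) => //; have := ltn_ord r; lia.
(* Read downwards from [D], the recurrence has [b] and [c] exchanged. The factor [sg] allows both
   [u] and [- u], since the sign of [u D] is not yet known. *)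
have right (sg : F) : 0 <= sg * u D -> forall i, (i <= D - s)%N ->
    sg * u D * (1 - (k - theta + rho2) * \sum_(r < i) (c (D - r)%N)^-1)
      <= sg * u (D - i)%N <= sg * u D.
  move=> sg_ge i i_le.
  have := @slow_decrease (D - s) (fun j => sg * u (D - j)%N)
    (fun j => c (D - j)%N) (fun j => b (D - j)%N) (k - theta) rho2 d_ge.
  rewrite subn0 => H.
  have [||H1 H2 _ _] := H _ _ sg_ge (ltW sumR) i i_le; last by rewrite H1 H2.
  - by move=> j j_lt; apply: bR; lia.
  - move=> j j_lt; have := @rec (D - j)%N (leq_subr _ _).
    (* At the end [D] the value [u D.+1] is removed by [b D = 0], so the reversed recurrence starts
       without a previous term. *)
    have [jE|j_gt] := eqVneq j 0%N.
      rewrite jE subn0 bD !mul0r subn1 => /(congr1 ( *%R sg)) H3; rewrite add0r.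
      by lra.
    have -> : (D - j.-1 = (D - j).+1)%N by lia.
    have -> : (D - j.+1 = (D - j).-1)%N by lia.
    by move=> /(congr1 ( *%R sg)); lra.
have us_gt := left s (leqnn s).
(* If [u D <= 0], the estimate for [- u] yields [u s <= 0]. *)
have uD_gt : 0 < u D.
  rewrite ltNge; apply/negP => uD_le.
  have := right (-1) _ (D - s)%N (leqnn _); rewrite !mulN1r oppr_ge0 subKn //.
  move=> /(_ uD_le) /andP[H _]; suff : 0 <= - u s by lra.
  apply: le_trans H; rewrite mulr_ge0 ?oppr_ge0 // subr_ge0 ltW //.
move=> i iD; have [/left//|i_gt] := leqP i s.
have := right 1 _ (D - i)%N; rewrite !mul1r subKn // => /(_ (ltW uD_gt)) H.
have {H}/andP[H _] := H (leq_sub2l _ (ltnW i_gt)).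
apply: lt_le_trans H; rewrite mulr_gt0 // subr_gt0; apply: le_lt_trans sumR.
have rho2_ge : 0 <= rho2.
  by have [_ /andP[q1 q2]] := bR i ltac:(lia); apply: le_trans q2.
rewrite ler_wpM2l //; first by rewrite addr_ge0.
rewrite -(subnKC (leq_sub2l D (ltnW i_gt))) big_split_ord /= lerDl sumr_ge0 // => r _.
by rewrite invr_ge0 ltW //; case: (bR (D - (D - i + r))%N) => //; have := ltn_ord r; lia.
Qed.

(** Since [b i + c i <= k], the coefficient of [u i] has absolute value at least [k / 2]. Small
    products [b i * c i.+1] then propagate [k / 4 * |u i| <= b i * |u i.+1|], so [u] never vanishes,
    and at [D] this contradicts [b D = 0]. *)
Lemma no_very_negative : 0 < k -> theta <= - (k / 2) -> u 0 != 0 ->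
  (forall i, (i <= D)%N -> [/\ 0 <= b i, 0 <= c i & b i + c i <= k]) ->
  (forall i, (i < D)%N -> b i * c i.+1 <= k ^+ 2 / 16) -> False.
Proof.
move=> k_gt th u0 bc prod.
have step i : (i <= D)%N -> k / 2 * `|u i| - c i * `|u i.-1| <= b i * `|u i.+1|.
  move=> iD; have [b_ge c_ge bc_le] := bc i iD.
  have E : b i * u i.+1 = (b i + c i - k + theta) * u i - c i * u i.-1.
    by have := rec iD; lra.
  rewrite -{1}(ger0_norm b_ge) -normrM E; apply: le_trans (lerB_dist _ _).
  rewrite !normrM (ger0_norm c_ge) lerD2r ler_wpM2r // ler0_norm; lra.
have main i : (i <= D)%N -> u i != 0 /\ k / 4 * `|u i| <= b i * `|u i.+1|.
  elim: i => [|i IH] iD.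
    split=> //; have := step 0%N iD; rewrite c0 mul0r subr0.
    by have := mulr_gt0 k_gt (etrans (normr_gt0 _) u0); lra.
  have [ui Hi] := IH (ltnW iD).
  have ui_gt : 0 < `|u i| by rewrite normr_gt0.
  have [b_ge _ _] := bc i (ltnW iD).
  have ui1 : u i.+1 != 0.
    by apply: contraTneq Hi => ->; rewrite normr0 mulr0 -ltNge mulr_gt0 // divr_gt0.
  split=> //; apply: le_trans (step _ iD).
  have [_ c_ge _] := bc i.+1 iD.
  suff : c i.+1 * `|u i| <= k / 4 * `|u i.+1| by rewrite /=; lra.
  have H1 := ler_wpM2l c_ge Hi.
  have H2 := ler_wpM2r (normr_ge0 (u i.+1)) (prod i iD).
  rewrite -(ler_pM2l (divr_gt0 k_gt (ltr0Sn F 3))).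
  by move: H1 H2; nra.
have [uD] := main D (leqnn D); rewrite bD mul0r leNgt mulr_gt0 ?normr_gt0 //.
by rewrite divr_gt0.
Qed.
End Tridiagonal.
End Recurrence.

(** * Growth of partial sums *)

Section Growth.
Local Open Scope ring_scope.
Variables (F : realFieldType) (g : nat -> F) (s : nat).
Local Notation S m := (\sum_(r < m) g r).
Hypotheses (g0 : g 0 = 1) (g_ge1 : forall r, (r < s)%N -> 1 <= g r).
Hypothesis g_half : forall j, (0 < j < s)%N ->
  4 * s%:R * g j <= (4 * s%:R + 1) * (S (uphalf j.+1) + S (j.+1 - uphalf j.+1)%N).

Lemma growth_sum_mono m n : (m <= n <= s)%N -> S m <= S n.
Proof.
move=> /andP[mn ns]; rewrite -(subnKC mn) big_split_ord /= lerDl sumr_ge0 // => r _.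
by apply: le_trans ler01 _; apply: g_ge1; have := ltn_ord r; lia.
Qed.

(** Both half sums in [g_half] are at most [S (uphalf m)], and twice [(4 s + 1) / (4 s)] is
    [2 + 1 / (2 s)]. In the application [g r] is [k / b r]. *)
Lemma growth_half m : (1 < m <= s)%N ->
  S m <= 1 + m.-1%:R * (2 + (2 * s%:R)^-1) * S (uphalf m).
Proof.
case: m => // m /andP[m_gt ms]; rewrite big_ord_recl g0 lerD2l -pred_Sn.
have s_gt : 0 < s%:R :> F by rewrite ltr0n; lia.
apply: (@le_trans _ _ (\sum_(r < m) (2 + (2 * s%:R)^-1) * S (uphalf m.+1))); last first.
  by rewrite sumr_const card_ord -[X in X <= _]mulr_natl mulrA.
apply: ler_sum => -[r rm] _; rewrite lift0 [nat_of_ord _]/=.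
have h1 : S (uphalf r.+2) <= S (uphalf m.+1) by apply: growth_sum_mono; lia.
have h2 : S (r.+2 - uphalf r.+2)%N <= S (uphalf m.+1) by apply: growth_sum_mono; lia.
have := g_half (j := r.+1) ltac:(lia).
have s4 : 0 < 4 * s%:R :> F by rewrite mulr_gt0.
rewrite -(ler_pM2l s4) => /le_trans; apply.
have -> : 4 * s%:R * ((2 + (2 * s%:R)^-1) * S (uphalf m.+1))
   = (4 * s%:R + 1) * (S (uphalf m.+1) + S (uphalf m.+1)).
  by field; rewrite gt_eqF.
by rewrite ler_wpM2l ?addr_ge0 ?mulr_ge0 // lerD.
Qed.

Lemma growth_sum2 : (1 < s)%N -> S 2 <= 4.
Proof.
move=> s_gt; have := @growth_half 2 ltac:(lia); rewrite big_ord1 g0 mulr1 mul1r.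
move/le_trans; apply.
have : (2 * s%:R)^-1 <= 1 :> F.
  by rewrite invf_le1 ?mulr_gt0 ?ltr0n -?natrM ?ler1n //; lia.
by lra.
Qed.

(** For [m > 2] the half sum [X] is at least 2. Hence the summand 1 and the excess
    [(m - 1) / (2 s) <= 1 / 2] of the factor together cost at most one more [X]. *)
Lemma growth_halving m : (2 < m <= s)%N -> S m <= (m.*2.-1)%:R * S (uphalf m).
Proof.
move=> /andP[m_gt ms]; have := @growth_half m ltac:(lia); move/le_trans; apply.
have X_ge : 2 <= S (uphalf m).
  apply: le_trans (@growth_sum_mono 2 (uphalf m) ltac:(lia)).
  by rewrite big_ord_recl big_ord1 /= g0 /bump /=; have := @g_ge1 1%N ltac:(lia); lra.
have -> : (m.*2.-1)%:R = 1 + 2 * m.-1%:R :> F.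
  by rewrite -natrM -(natrD _ 1); congr (_%:R); lia.
have ms' : m.-1%:R * (2 * s%:R)^-1 <= 2^-1 :> F.
  have s2 : 0 < 2 * s%:R :> F by rewrite mulr_gt0 // ltr0n; lia.
  by rewrite ler_pdivrMr // mulKf ?pnatr_eq0 // ler_nat; lia.
have H := ler_wpM2r (le_trans (ler0n F 2) X_ge) ms'.
by move: (2 * s%:R)^-1 (S (uphalf m)) X_ge H => t X X_ge H; nra.
Qed.

(** Repeated halving, down to [m <= 4] where [S 2 <= 4] finishes. After a halving the next factor
    [2 (uphalf m) - 1] is at most [m], so only the first factor is not bounded by [m]. *)
Lemma growth_bound p m : (0 < m <= s)%N -> (m <= 2 ^ p.+2)%N ->
  S m <= (4 * m.*2.-1 * m ^ p)%:R.
Proof.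
elim: p m => [|p IH] m /andP[m_gt ms] m_le.
  have [m1|m1] := leqP m 1; first by rewrite (_ : m = 1%N) ?big_ord1 ?g0 ?ler1n //; lia.
  have S2 := growth_sum2 ltac:(lia).
  have [m2|m2] := leqP m 2.
    by rewrite (_ : m = 2%N); [apply: le_trans S2 _; rewrite ler_nat | lia].
  apply: le_trans (growth_halving _) _; first by rewrite m2.
  have -> : uphalf m = 2%N by move: m_le; rewrite (_ : 2 ^ 2 = 4)%N //; lia.
  by rewrite expn0 muln1 mulnC natrM ler_wpM2l.
have [m2|m2] := leqP m 2.
  have m_pow : (1 <= m ^ p.+1)%N by rewrite expn_gt0 m_gt.
  apply: (@le_trans _ _ (4 * m.*2.-1)%:R); last by rewrite ler_nat leq_pmulr.
  have [m1|m1] := leqP m 1; first by rewrite (_ : m = 1%N) ?big_ord1 ?g0 ?ler1n //; lia.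
  have -> : m = 2%N by lia.
  by apply: le_trans (growth_sum2 _) _; rewrite ?ler_nat //; lia.
apply: le_trans (growth_halving _) _; first by rewrite m2.
have := IH (uphalf m) ltac:(lia) ltac:(move: m_le; rewrite (expnS 2 p.+2); lia).
move=> /(ler_wpM2l (ler0n F (m.*2.-1))) /le_trans; apply.
rewrite -natrM ler_nat mulnA [(m.*2.-1 * _)%N]mulnC expnS -!mulnA leq_mul2l /=.
rewrite mulnCA leq_mul2l; apply/orP; right.
apply: leq_mul; first by lia.
by case: (p) => [|p'] //; rewrite leq_exp2r //; lia.
Qed.
End Growth.

(** * Distance-regular graphs *)

(* With [N := pow_log d <= d ^ log2 d] and [A := inv_eps_root d], the constants
   of the theorem satisfy [eta <= 1 / (4 d N)] and [eps <= A ^ -3]; all estimates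
   are carried out with these rational bounds. *)
Definition pow_log (d : nat) := d ^ trunc_log 2 d.
Definition inv_eps_root (d : nat) := 200 * d ^ 3 * pow_log d.

Lemma card_andb (T : finType) (P Q : pred T) :
  #|[set u | P u && Q u]| = \sum_(u | P u) Q u.
Proof.
rewrite -sum1_card (eq_bigl _ _ (fun x => in_set _ _)) big_mkcondr.
by apply: eq_bigr => u _; case: (Q u).
Qed.

Section DistanceRegular.
Variables (T : finType) (e : rel T) (a b c : nat -> nat).
Hypotheses (e_sym : symmetric e) (e_irr : irreflexive e) (e_conn : connected e).
Hypotheses (d_gt0 : 0 < diameter e) (drg : distance_regular e a b c).
Variable v0 : T.

Local Notation dist := (dist e).
Local Notation D := (diameter e).
Local Notation sphere z l := [set x | dist z x == l].

Definition sphere_size (l : nat) := #|sphere v0 l|.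

Lemma dist_nbr v w u : e w u ->
  [\/ (dist v u).+1 = dist v w, dist v u = dist v w | dist v u = (dist v w).+1].
Proof.
move=> ewu; have := dist_edge e_conn v ewu.
have := dist_edge_sym e_sym e_conn v ewu.
case: (ltngtP (dist v u) (dist v w)) => [h|h|->] h1 h2;
  [apply: Or31|apply: Or33|exact: Or32]; lia.
Qed.

Lemma nbr_sum (V : zmodType) (f : nat -> V) v w :
  (\sum_(u | e w u) f (dist v u) =
   f (dist v w).-1 *+ c (dist v w) + f (dist v w) *+ a (dist v w)
     + f (dist v w).+1 *+ b (dist v w))%R.
Proof.
have [<- <- <-] := drg v w.
rewrite -!sumr_const (bigID (fun u => (dist v u).+1 == dist v w)) /=.
rewrite -[RHS]addrA; congr (_ + _)%R.
  by apply: eq_big => [u|u /andP[_ /eqP<-]]; rewrite ?inE.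
rewrite (bigID (fun u => dist v u == dist v w)) /=; congr (_ + _)%R.
  apply: eq_big => [u|u /andP[_ /eqP<-]] //; rewrite inE -andbA.
  by case: (e w u) => //=; lia.
apply: eq_big => [u|u /andP[/andP[ewu h1] h2]].
  rewrite inE; case ewu: (e w u) => //=.
  by case: (dist_nbr v ewu) => h; lia.
by case: (dist_nbr v ewu) => h; move: h1 h2; rewrite h ?eqxx.
Qed.

Lemma c_zero : c 0 = 0.
Proof.
have [] := drg v0 v0; rewrite (distxx e_conn) => <- _ _.
by apply: eq_card0 => u; rewrite inE andbF.
Qed.

Lemma degree w : #|[set u | e w u]| = b 0.
Proof.
have [] := drg w w; rewrite (distxx e_conn) => _ _ <-; apply: eq_card => u; rewrite !inE.
case ewu: (e w u) => //=; have := dist_edge1 e_conn ewu.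
have: dist w u != 0 by rewrite (dist_eq0 e_conn); apply/eqP => wu; rewrite wu e_irr in ewu.
by lia.
Qed.

Lemma abc_sum i : i <= D -> c i + a i + b i = b 0.
Proof.
move=> /(exists_dist e_conn d_gt0)[v [w <-]].
have := nbr_sum (fun=> 1%R : int) v w.
rewrite sumr_const -!mulrnDr -(degree w) cardsE => /eqP.
by rewrite eqr_nat => /eqP->.
Qed.

Lemma c_gt0 i : 0 < i <= D -> 0 < c i.
Proof.
case/andP; case: i => // i _ /(exists_dist e_conn d_gt0)[v [w dvw]].
have [u euw dvu] := dist_pred e_conn dvw.
rewrite -dvw; have [<- _ _] := drg v w; apply/card_gt0P; exists u.
by rewrite inE e_sym euw dvu dvw eqxx.
Qed.

Lemma b_gt0 i : i < D -> 0 < b i.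
Proof.
move=> /(exists_dist e_conn d_gt0)[v [w dvw]].
have [u euw dvu] := dist_pred e_conn dvw.
rewrite -dvu; have [_ _ <-] := drg v u; apply/card_gt0P; exists w.
by rewrite inE euw dvu dvw eqxx.
Qed.

Lemma b_diameter : b D = 0.
Proof.
have [v [w dvw]] := dist_diameter d_gt0; have [_ _] := drg v w; rewrite dvw => <-.
apply: eq_card0 => u; rewrite inE; apply/negP => /andP[_ /eqP h].
by have := dist_le_diameter e v u; rewrite h ltnn.
Qed.


(** If [x] follows [v] on a geodesic to [w], a neighbour of [w] that is closer to [x] is also closer
    to [v]. *)
Lemma c_mono i : i < D -> c i <= c i.+1.
Proof.
move=> iD; have [v [w dvw]] := exists_dist e_conn d_gt0 iD.
have [x dvx dxw] : exists2 x, dist v x = 1 & dist x w = i.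
  by have [|x ? dxw] := @dist_between _ _ e_conn v w 1; [lia | exists x; lia].
rewrite -dvw -dxw; have [<- _ _] := drg x w; have [<- _ _] := drg v w.
apply/subset_leq_card/subsetP => u; rewrite !inE => /andP[ewu /eqP h].
rewrite ewu /=; have := dist_triangle e_conn v x u.
by have := dist_edge_sym e_sym e_conn v ewu; lia.
Qed.

Lemma b_mono i : i < D -> b i.+1 <= b i.
Proof.
move=> iD; have [v [w dvw]] := exists_dist e_conn d_gt0 iD.
have [x dvx dxw] : exists2 x, dist v x = 1 & dist x w = i.
  by have [|x ? dxw] := @dist_between _ _ e_conn v w 1; [lia | exists x; lia].
rewrite -dvw -dxw; have [_ _ <-] := drg x w; have [_ _ <-] := drg v w.
apply/subset_leq_card/subsetP => u; rewrite !inE => /andP[ewu /eqP h].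
rewrite ewu /=; have := dist_triangle e_conn v x u.
by have := dist_edge e_conn x ewu; lia.
Qed.

Lemma c_le i j : i <= j -> j <= D -> c i <= c j.
Proof.
move=> /subnK <-; elim: (j - i) => // n IH h; apply: leq_trans (IH _) (c_mono _); lia.
Qed.

Lemma b_le i j : i <= j -> j <= D -> b j <= b i.
Proof.
move=> /subnK <-; elim: (j - i) => // n IH h; apply: leq_trans (b_mono _) (IH _); lia.
Qed.

Lemma b_le_degree i : i <= D -> b i <= b 0.
Proof. by move/abc_sum; lia. Qed.

Lemma c_le_degree i : i <= D -> c i <= b 0.
Proof. by move/abc_sum; lia. Qed.

(** * Invariance of the intersection numbers *)

Section IntersectionNumbers.
Local Open Scope ring_scope.
Variable F : numFieldType.

(** This is the matrix product [A_i M], with [A_i] the distance-[i] matrix of the graph. *)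
Definition sphere_sum (i : nat) (M : T -> T -> F) x y := \sum_(u | dist x u == i) M u y.

Lemma nbr_sphere_indicator i x u : \sum_(z | e x z) (dist z u == i)%:R =
    (if i is i'.+1 then (dist x u == i')%:R * (b i')%:R else 0)
      + (dist x u == i)%:R * (a i)%:R + (dist x u == i.+1)%:R * (c i.+1)%:R :> F.
Proof.
under eq_bigr => z _ do rewrite (dist_sym e_sym e_conn).
rewrite (nbr_sum (fun n => (n == i)%:R : F)) (dist_sym e_sym e_conn u x).
set t := dist x u.
rewrite -[X in X + _ + _]mulr_natr -[X in _ + X + _]mulr_natr -[X in _ + _ + X = _]mulr_natr.
rewrite addrC [X in _ + X]addrC addrA.
congr (_ + _ + _).
- by case: i => [|i] /=; rewrite ?mul0r ?eqSS //; case: eqP => [->|]; rewrite ?mul0r.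
- by case: eqP => [->|]; rewrite ?mul0r.
- case: t => [|t] /=; rewrite ?c_zero ?mulr0 ?mul0r ?eqSS //.
  by case: eqP => [->|]; rewrite ?mul0r.
Qed.

(** The relation [A_1 A_i = b_(i-1) A_(i-1) + a_i A_i + c_(i+1) A_(i+1)], multiplied by [M]. *)
Lemma nbr_sphere_sum i M x y :
  \sum_(z | e x z) sphere_sum i M z y =
  (if i is i'.+1 then (b i')%:R * sphere_sum i' M x y else 0)
    + (a i)%:R * sphere_sum i M x y + (c i.+1)%:R * sphere_sum i.+1 M x y.
Proof.
have swap j : \sum_u (dist x u == j)%:R * M u y = sphere_sum j M x y.
  rewrite /sphere_sum [RHS]big_mkcond; apply: eq_bigr => u _.
  by case: eqP; rewrite ?mul1r ?mul0r.
transitivity (\sum_u (\sum_(z | e x z) (dist z u == i)%:R) * M u y).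
  under [RHS]eq_bigr do rewrite mulr_suml.
  rewrite exchange_big /=; apply: eq_bigr => z _.
  rewrite /sphere_sum [LHS]big_mkcond; apply: eq_bigr => u _.
  by case: eqP; rewrite ?mul1r ?mul0r.
under eq_bigr => u _ do rewrite nbr_sphere_indicator !mulrDl.
rewrite !big_split /=; congr (_ + _ + _).
- case: i => [|i]; first by rewrite big1 // => u _; rewrite mul0r.
  by rewrite -swap mulr_sumr; apply: eq_bigr => u _; ring.
- by rewrite -swap mulr_sumr; apply: eq_bigr => u _; ring.
- by rewrite -swap mulr_sumr; apply: eq_bigr => u _; ring.
Qed.

(** These are the matrices in the span of the distance matrices, the Bose-Mesner algebra. *)
Definition dist_invariant (M : T -> T -> F) :=
  exists m : nat -> F, forall x y, M x y = m (dist x y).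

(** Neighbour sums preserve invariance by [nbr_sum], so the three-term relation can be solved for
    [A_(n+1) M], dividing by [c n.+1]. Beyond the diameter the spheres are empty. *)
Lemma sphere_sum_invariant i M :
  dist_invariant M -> dist_invariant (sphere_sum i M).
Proof.
move=> [m Mm].
suff H n : (n <= i)%N -> dist_invariant (sphere_sum n M) by exact: H.
elim/ltn_ind: n => -[_ _|n IH n_le].
  exists m => x y; rewrite /sphere_sum (big_pred1 x) // => u /=.
  by rewrite (dist_eq0 e_conn) eq_sym.
have [mn Hn] := IH n ltac:(lia) ltac:(lia).
have [mp Hp] : exists mp : nat -> F, forall x y,
    (if n is n'.+1 then (b n')%:R * sphere_sum n' M x y else 0) = mp (dist x y).
  case: n IH {mn Hn} n_le => [|n] IH n_le; first by exists (fun=> 0).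
  have [mp Hp] := IH n ltac:(lia) ltac:(lia).
  by exists (fun t => (b n)%:R * mp t) => x y; rewrite Hp.
have [nD|nD] := leqP n.+1 D; last first.
  exists (fun=> 0) => x y; apply: big_pred0 => u.
  by apply/eqP => h; have := dist_le_diameter e x u; lia.
have c_neq0 : (c n.+1)%:R != 0 :> F by rewrite pnatr_eq0 -lt0n c_gt0.
exists (fun t => ((mn t.-1 *+ c t + mn t *+ a t + mn t.+1 *+ b t)
                   - (mp t + (a n)%:R * mn t)) / (c n.+1)%:R) => x y.
have := nbr_sphere_sum n M x y; rewrite Hp Hn.
under eq_bigr => z _ do rewrite Hn (dist_sym e_sym e_conn).
rewrite nbr_sum (dist_sym e_sym e_conn y x) => ->.
by rewrite [X in X - _]addrC addrK mulrC mulKf.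
Qed.

End IntersectionNumbers.

Lemma sphere_count_invariant l (R : pred nat) z w z' w' : dist z w = dist z' w' ->
  #|[set x | (dist z x == l) && R (dist x w)]|
    = #|[set x | (dist z' x == l) && R (dist x w')]|.
Proof.
move=> dd; have [m mE] : dist_invariant
    (sphere_sum l (fun x y => (R (dist x y))%:R%R : rat)).
  by apply: sphere_sum_invariant; exists (fun t => (R t)%:R%R).
suff cE v u : (#|[set x | (dist v x == l) && R (dist x u)]|%:R = m (dist v u))%R.
  by apply/eqP; rewrite -(eqr_nat rat) !cE dd.
rewrite -mE /sphere_sum card_andb natr_sum.
by apply: eq_bigr => x _; case: (R _).
Qed.

Lemma card_sphere z l : #|sphere z l| = sphere_size l.
Proof.
have := @sphere_count_invariant l predT z z v0 v0; rewrite !(distxx e_conn) => /(_ erefl).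
rewrite /sphere_size !card_andb /= => H.
by rewrite -!sum1_card !(eq_bigl _ _ (fun x => in_set _ _)).
Qed.

(** Both sides count the edges between two consecutive spheres. *)
Lemma sphere_size_rec l : sphere_size l * b l = sphere_size l.+1 * c l.+1.
Proof.
transitivity (\sum_(x | dist v0 x == l) \sum_(u | dist v0 u == l.+1) e x u).
  rewrite -sum_nat_const (eq_bigl _ _ (fun x => in_set _ _)).
  apply: eq_bigr => x /eqP dx; rewrite -card_andb -dx; have [_ _ <-] := drg v0 x.
  by apply: eq_card => u; rewrite !inE andbC.
rewrite exchange_big /= -sum_nat_const (eq_bigl _ _ (fun x => in_set _ _)).
apply: eq_bigr => x /eqP dx; rewrite -card_andb -dx; have [<- _ _] := drg v0 x.
by apply: eq_card => u; rewrite !inE dx eqSS andbC e_sym.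
Qed.

Lemma sphere_size_gt0 l : l <= D -> 0 < sphere_size l.
Proof.
move=> /(exists_dist e_conn d_gt0)[v [w dvw]]; rewrite -(card_sphere v).
by apply/card_gt0P; exists w; rewrite inE dvw.
Qed.

(** Double counting of the pairs from the spheres of radii [l] and [r] around [z] whose distance
    satisfies [R]; by invariance every point of a sphere contributes equally. *)
Lemma sphere_count_swap (R : pred nat) z w x r l : dist z w = r -> dist z x = l ->
  sphere_size r * #|[set x' | (dist z x' == l) && R (dist x' w)]|
    = sphere_size l * #|[set w' | (dist z w' == r) && R (dist w' x)]|.
Proof.
move=> dw dx; transitivity (\sum_(w' | dist z w' == r)
    \sum_(x' | dist z x' == l) R (dist x' w')).
  rewrite -(card_sphere z) -sum_nat_const (eq_bigl _ _ (fun x => in_set _ _)).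
  apply: eq_bigr => w' /eqP dw'; rewrite -card_andb.
  by apply: sphere_count_invariant; rewrite dw dw'.
rewrite exchange_big /= -(card_sphere z) -sum_nat_const (eq_bigl _ _ (fun x => in_set _ _)).
apply: eq_bigr => x' /eqP dx'; under eq_bigr do rewrite (dist_sym e_sym e_conn).
by rewrite -card_andb; apply: sphere_count_invariant; rewrite dx dx'.
Qed.

(** * Loss of points along a geodesic *)

Section Drift.
Variables (P : pred nat) (M l : nat).
Hypothesis exit_bound : forall z y, P (dist z y) ->
  #|[set y' | e y y' && ~~ P (dist z y')]| <= M.

Let exits x y := #|[set z | (dist x z == l) && ~~ P (dist z y)]|.

(** By invariance [exits x] takes one value on all forward neighbours of [y0], so it can be summed
    over them; a point that satisfies [P] at [y0] is lost for at most [M] of them. *)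
Lemma drift_step x y0 y : e y0 y -> dist x y = (dist x y0).+1 ->
  b (dist x y0) * exits x y <= b (dist x y0) * exits x y0 + sphere_size l * M.
Proof.
move=> ey dy; rewrite -(card_sphere x); have [_ _ <-] := drg x y0.
rewrite -!sum_nat_const !(eq_bigl _ _ (fun x => in_set _ _)).
have -> : \sum_(y' | e y0 y' && (dist x y' == (dist x y0).+1)) exits x y
    = \sum_(y' | e y0 y' && (dist x y' == (dist x y0).+1)) exits x y'.
  apply: eq_bigr => y' /andP[_ /eqP dy'].
  by apply: (sphere_count_invariant _ (fun n => ~~ P n)); rewrite dy dy'.
apply: (@leq_trans (\sum_(y' | e y0 y' && (dist x y' == (dist x y0).+1))
   (exits x y0 + \sum_(z | dist x z == l) (P (dist z y0) && ~~ P (dist z y'))))).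
  apply: leq_sum => y' _; rewrite /exits !card_andb -big_split /=.
  by apply: leq_sum => z _; case: (P _); case: (P _).
rewrite big_split leq_add2l exchange_big /=.
apply: leq_sum => z _; case Pz: (P (dist z y0)); last by rewrite big1.
apply: leq_trans (exit_bound Pz); rewrite card_andb.
by rewrite [X in X <= _]big_mkcondr; apply: leq_sum => y' _; case: ifP.
Qed.

(** At [y = x] no point is lost, because [P l]; the step leaving distance [r] then loses at most the
    fraction [M / b r] of the sphere. *)
Lemma drift (F : numFieldType) x y : P l ->
  ((exits x y)%:R <= (sphere_size l * M)%:R * \sum_(r < dist x y) (b r)%:R^-1 :> F)%R.
Proof.
move=> Pl; move En: (dist x y) => n; elim: n y En => [|n IH] y En.
  rewrite big_ord0 mulr0 lern0 /exits cards_eq0; apply/eqP/setP => z; rewrite !inE.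
  move/eqP: En; rewrite (dist_eq0 e_conn) => /eqP <-.
  by rewrite (dist_sym e_sym e_conn); case: eqP => //= ->; rewrite Pl.
have [y0 ey dy0] := dist_pred e_conn En.
have := drift_step (x := x) ey; rewrite En dy0 => /(_ erefl).
rewrite big_ord_recr /= mulrDr => H; have := IH _ dy0.
have b_gt : (0 < (b n)%:R :> F)%R.
  by rewrite ltr0n b_gt0 //; have := dist_le_diameter e x y; lia.
rewrite -(lerD2r ((sphere_size l * M)%:R / (b n)%:R)); apply: le_trans.
by rewrite -(ler_pM2l b_gt) mulrDr mulrCA divff ?gt_eqF // mulr1 -!natrM -natrD ler_nat.
Qed.
End Drift.

Lemma exit_ball j z y : dist z y <= j ->
  #|[set y' | e y y' && ~~ (dist z y' <= j)]| <= b j.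
Proof.
rewrite leq_eqVlt => /orP[/eqP<-|lt].
  have [_ _ <-] := drg z y; apply/subset_leq_card/subsetP => u; rewrite !inE.
  by case/andP=> eyu h; have := dist_edge e_conn z eyu; rewrite eyu /=; lia.
rewrite (_ : [set _ | _] = set0) ?cards0 //; apply/setP => u; rewrite !inE.
by apply/andP=> -[eyu h]; have := dist_edge e_conn z eyu; lia.
Qed.

Lemma exit_ball_compl j z y : j < dist z y ->
  #|[set y' | e y y' && ~~ (j < dist z y')]| <= c j.+1.
Proof.
rewrite leq_eqVlt => /orP[/eqP->|lt].
  have [<- _ _] := drg z y; apply/subset_leq_card/subsetP => u; rewrite !inE.
  by case/andP=> eyu h; have := dist_edge_sym e_sym e_conn z eyu; rewrite eyu /=; lia.
rewrite (_ : [set _ | _] = set0) ?cards0 //; apply/setP => u; rewrite !inE.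
by apply/andP=> -[eyu h]; have := dist_edge_sym e_sym e_conn z eyu; lia.
Qed.

Lemma exit_sphere j z y : dist z y == j ->
  #|[set y' | e y y' && ~~ (dist z y' == j)]| <= b j + c j.
Proof.
move=> /eqP<-; have [<- _ <-] := drg z y.
apply: leq_trans (leq_card_setU _ _).
apply/subset_leq_card/subsetP => u; rewrite !inE => /andP[eyu h].
by rewrite eyu /=; have := dist_nbr z eyu; case; lia.
Qed.

Lemma card_le_partition (f : T -> nat) (Q : pred T) j :
  #|[set u | (f u <= j) && Q u]| <= \sum_(l < j.+1) #|[set u | (f u == l) && Q u]|.
Proof.
elim: j => [|j IH]; rewrite big_ord_recr /=.
  by rewrite big_ord0; apply/subset_leq_card/subsetP => u; rewrite !inE leqn0.
apply: leq_trans (leq_add IH (leqnn _)); apply: leq_trans (leq_card_setU _ _).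
by apply/subset_leq_card/subsetP => u; rewrite !inE -andb_orl; case: (Q u); lia.
Qed.

Lemma sphere_size_mono l j : j <= D -> (forall i, i < j -> c i.+1 <= b i) ->
  l <= j -> sphere_size l <= sphere_size j.
Proof.
elim: j => [|j IH] jD cb; first by rewrite leqn0 => /eqP->.
rewrite leq_eqVlt => /orP[/eqP->//|l_le].
apply: leq_trans (IH (ltnW jD) _ l_le) _ => [i ij|]; first by rewrite cb // ltnW.
have := sphere_size_rec j; have := b_gt0 jD; have := cb j (ltnSn j).
by move=> cbj bj E; rewrite -(leq_pmul2r bj) E leq_mul2l cbj orbT.
Qed.

(** For each radius [l], [sphere_count_swap] replaces the points of [S_l(x)] near [z] by the points
    of [S_(j+1)(x)] in a ball of radius [j], and such a ball has at most [j.+1 * sphere_size j]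
    points. *)
Lemma ball_intersection_bound j x z : dist x z = j.+1 ->
  (forall i, i < j -> c i.+1 <= b i) ->
  sphere_size j.+1 * #|[set u | (dist x u <= j) && (dist u z <= j)]|
    <= (j.+1 * sphere_size j) ^ 2.
Proof.
move=> dxz cb; have jD : j <= D by have := dist_le_diameter e x z; lia.
have mono l : l < j.+1 -> sphere_size l <= sphere_size j.
  by move=> l_le; apply: sphere_size_mono.
have ball_le w : #|[set u | dist w u <= j]| <= j.+1 * sphere_size j.
  have := card_le_partition (dist w) predT j; under eq_finset do rewrite andbT.
  move=> /leq_trans; apply; rewrite -[X in X * _]card_ord -sum_nat_const.
  apply: leq_sum => l _; under eq_finset do rewrite andbT.
  by rewrite card_sphere mono.
apply: (@leq_trans (sphere_size j.+1 *
    \sum_(l < j.+1) #|[set u | (dist x u == l) && (dist u z <= j)]|)).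
  by rewrite leq_mul2l card_le_partition orbT.
rewrite big_distrr /= expnS expn1 -mulnA -[X in X * _]card_ord -sum_nat_const.
apply: leq_sum => l _.
have [w dw _] : exists2 w, dist x w = l & dist w z = dist x z - l.
  by apply: (dist_between e_conn); have := ltn_ord l; lia.
rewrite (sphere_count_swap (fun n => n <= j) dxz dw) leq_mul ?mono //.
apply: leq_trans (ball_le w); apply/subset_leq_card/subsetP => u; rewrite !inE.
by rewrite (dist_sym e_sym e_conn w) => /andP[].
Qed.

(** * Inequalities between the parameters [b] and [c] *)

Section Tradeoffs.
Local Open Scope ring_scope.
Variable F : realFieldType.

Definition binv_sum (i : nat) : F := \sum_(r < i) (b r)%:R^-1.

(** Let [y] lie on a geodesic from [x] to [z]. Up to two drift losses, the sphere of radius [j]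
    around [y] lies in both balls of radius [j] around [x] and [z], whose intersection is small.
    Then [k_j b_j = k_(j+1) c_(j+1)] eliminates the sphere sizes. *)
Lemma tradeoff_b i j : (j < D)%N -> (i <= j.+1)%N ->
  (forall l, (l < j)%N -> (c l.+1 <= b l)%N) ->
  (b j)%:R * (1 - (b j)%:R * (binv_sum i + binv_sum (j.+1 - i)))
    <= j.+1%:R ^+ 2 * (c j.+1)%:R.
Proof.
move=> jD ij cb; have [x [z dxz]] := exists_dist e_conn d_gt0 jD.
have [y dxy dyz] := @dist_between _ _ e_conn x z i ltac:(lia).
have [dyx dzy] := (dist_sym e_sym e_conn y x, dist_sym e_sym e_conn z y).
have Ex := @drift (fun n => n <= j)%N (b j) j (@exit_ball j) F y x (leqnn j).
have Ez := @drift (fun n => n <= j)%N (b j) j (@exit_ball j) F y z (leqnn j).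
rewrite /= dyx dxy natrM in Ex; rewrite /= dyz dxz natrM in Ez.
have I_le := ball_intersection_bound dxz cb.
set I := #|_| in I_le.
have : (sphere_size j <= #|[set u | (dist y u == j) && ~~ (dist u x <= j)]|
   + #|[set u | (dist y u == j) && ~~ (dist u z <= j)]| + I)%N.
  rewrite -(card_sphere y).
  apply: leq_trans (leq_add (leq_card_setU _ _) (leqnn _)).
  apply: leq_trans (leq_card_setU _ _).
  apply/subset_leq_card/subsetP => u; rewrite !inE => ->.
  by rewrite (dist_sym e_sym e_conn x u) /=; do 2!case: (_ <= j)%N.
rewrite -(ler_nat F) !natrD => H.
move: I_le; rewrite -(ler_nat F) natrM natrX natrM => I_le.
have k_gt : 0 < (sphere_size j)%:R :> F by rewrite ltr0n sphere_size_gt0 // ltnW.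
have k1_ge : 0 <= (sphere_size j.+1)%:R :> F by [].
have C_ge : 0 <= (c j.+1)%:R :> F by [].
have kE : (sphere_size j)%:R * (b j)%:R = (sphere_size j.+1)%:R * (c j.+1)%:R :> F.
  by rewrite -!natrM sphere_size_rec.
rewrite -/(binv_sum i) in Ex; rewrite -/(binv_sum (j.+1 - i)) in Ez.
move: H Ex Ez I_le k_gt k1_ge C_ge kE.
move: (sphere_size j)%:R (sphere_size j.+1)%:R (b j)%:R (c j.+1)%:R j.+1%:R
 (binv_sum i) (binv_sum (j.+1 - i)) I%:R => k k1 B C J S1 S2 I'.
move: (_%:R) (_%:R) => E1 E2 H Ex Ez I_le k_gt k1_ge C_ge kE.
have H1 : k * (1 - B * (S1 + S2)) <= I' by lra.
have H2 : k1 * (1 - B * (S1 + S2)) <= J ^+ 2 * k.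
  have := ler_wpM2l k1_ge H1 => H2; have {}H2 := le_trans H2 I_le.
  rewrite -(ler_pM2l k_gt) mulrCA (le_trans H2) // le_eqVlt; apply/orP; left.
  by apply/eqP; ring.
have H3 := ler_wpM2r C_ge H2; rewrite -(ler_pM2l k_gt).
rewrite (_ : k * (B * _) = k1 * (1 - B * (S1 + S2)) * C); last by rewrite mulrA kE mulrAC.
by rewrite (le_trans H3) // le_eqVlt; apply/orP; left; apply/eqP; ring.
Qed.

(** Let [y] be the neighbour of [x] on a geodesic from [z]. A point [u] of [S_s(z)] has
    [dist u y <> s], or [dist u y = s] and [dist u x <> s], or [dist u x <= s]. The first two cases
    are drift losses from a sphere. *)
Lemma tradeoff_c s : (s < D)%N ->
  1 <= (c s.+1)%:R * binv_sum s
       + (b s + c s)%:R * (binv_sum s + (b 0)%:R^-1).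
Proof.
move=> sD; have [z [x dzx]] := exists_dist e_conn d_gt0 sD.
have [y dzy dyx] := @dist_between _ _ e_conn z x s ltac:(lia).
have dyx1 : dist y x = 1%N by lia.
have E1 := @drift (fun n => n == s)%N _ s (@exit_sphere s) F z y (eqxx s).
have E2 := @drift (fun n => n == s)%N _ s (@exit_sphere s) F y x (eqxx s).
have E3 := @drift (fun n => s < n)%N _ s.+1 (@exit_ball_compl s) F z y (leqnn s.+1).
(* The third case is exchanged for the points of [S_(s+1)(z)] within distance [s] of [y], a drift
   loss from the complement of a ball. *)
have sw := sphere_count_swap (fun n => ~~ (s < n))%N dzy dzx.
rewrite /= in sw; rewrite /= dzy -/(binv_sum s) in E1; rewrite /= dzy -/(binv_sum s) in E3.
rewrite /= dyx1 big_ord1 in E2.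
have : (sphere_size s <= #|[set u | (dist z u == s) && ~~ (dist u y == s)]|
   + #|[set u | (dist y u == s) && ~~ (dist u x == s)]|
   + #|[set u | (dist z u == s) && ~~ (s < dist u x)]|)%N.
  rewrite -(card_sphere z).
  apply: leq_trans (leq_add (leq_card_setU _ _) (leqnn _)).
  apply: leq_trans (leq_card_setU _ _).
  apply/subset_leq_card/subsetP => u; rewrite !inE => ->.
  rewrite (dist_sym e_sym e_conn y u) /=; case: eqP => //= _.
  by case: eqP => //= ->; rewrite ltnn.
rewrite -(ler_nat F) !natrD => H.
have k_gt : 0 < (sphere_size s)%:R :> F by rewrite ltr0n sphere_size_gt0 // ltnW.
have k1_gt : 0 < (sphere_size s.+1)%:R :> F by rewrite ltr0n sphere_size_gt0.
move: sw => /(congr1 (fun n => n%:R : F)); rewrite !natrM => sw.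
rewrite natrM natrD in E1; rewrite natrM natrD in E2; rewrite natrM in E3.
set N3 := #|[set u | (dist z u == s) && ~~ (s < dist u x)%N]| in sw H *.
set N4 := #|[set u | (dist z u == s.+1) && ~~ (s < dist u y)%N]| in sw E3 *.
move: H E1 E2 E3 sw k_gt k1_gt; move: N3%:R N4%:R => N3' N4'.
move: (sphere_size s)%:R (sphere_size s.+1)%:R (b s)%:R (c s)%:R (c s.+1)%:R
 (binv_sum s) (b 0)%:R^-1 => k k1 B C C1 S b0.
move: (_%:R) (_%:R) => N1 N2 H E1 E2 E3 sw k_gt k1_gt.
have E4 : N3' <= k * C1 * S.
  by rewrite -(ler_pM2l k1_gt) -sw; have := ler_wpM2l (ltW k_gt) E3; nra.
by rewrite -(ler_pM2l k_gt); nra.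
Qed.
End Tradeoffs.

(** * Averages of an eigenfunction over spheres *)

Section StandardSequence.
Local Open Scope ring_scope.
Variables (F : numFieldType) (w : T -> F) (theta : F).
Hypothesis eigen : forall x, \sum_(y | e x y) w y = theta * w x.

Lemma nbr_sum_sphere i :
  theta * (\sum_(x | dist v0 x == i) w x) =
  (if i is i'.+1 then (b i')%:R * \sum_(x | dist v0 x == i') w x else 0)
    + (a i)%:R * (\sum_(x | dist v0 x == i) w x)
    + (c i.+1)%:R * \sum_(x | dist v0 x == i.+1) w x.
Proof.
have ind j : \sum_(x | dist v0 x == j) w x = \sum_x (dist x v0 == j)%:R * w x.
  rewrite big_mkcond; apply: eq_bigr => x _; rewrite (dist_sym e_sym e_conn).
  by case: eqP; rewrite ?mul1r ?mul0r.
transitivity (\sum_y w y * \sum_(x | e y x) (dist x v0 == i)%:R).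
  rewrite ind mulr_sumr; under [RHS]eq_bigr do rewrite mulr_sumr.
  transitivity (\sum_x \sum_(y | e x y) (dist x v0 == i)%:R * w y).
    by apply: eq_bigr => x _; rewrite mulrCA -eigen mulr_sumr.
  rewrite (exchange_big_dep predT) //=; apply: eq_bigr => y _.
  by apply: eq_big => [x|x _]; [exact: e_sym | exact: mulrC].
under eq_bigr => y _ do rewrite nbr_sphere_indicator !mulrDr.
rewrite !big_split /= !ind; congr (_ + _ + _).
- case: i => [|i]; first by rewrite big1 // => y _; rewrite mulr0.
  by rewrite ind mulr_sumr; apply: eq_bigr => y _; ring.
- by rewrite mulr_sumr; apply: eq_bigr => y _; ring.
- by rewrite mulr_sumr; apply: eq_bigr => y _; ring.
Qed.

(* [u D.+1] is the junk value [0 / 0 = 0]; it only occurs multiplied by [b D = 0]. *)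
Lemma standard_sequence : exists u : nat -> F,
  [/\ u 0 = w v0,
      forall i, (i <= D)%N -> (b i)%:R * (u i - u i.+1)
        = (c i)%:R * (u i.-1 - u i) + ((b 0)%:R - theta) * u i &
      \sum_x w x = \sum_(i < D.+1) (sphere_size i)%:R * u i].
Proof.
pose U i := \sum_(x | dist v0 x == i) w x.
pose u i := U i / (sphere_size i)%:R.
have Uu i : U i = (sphere_size i)%:R * u i.
  rewrite /u; have [k0|k0] := eqVneq (sphere_size i) 0%N.
    rewrite k0 mul0r /U big_pred0 // => x; apply/negP => dx.
    move: k0; rewrite /sphere_size => /eqP; rewrite cards_eq0 => /eqP/setP/(_ x).
    by rewrite !inE dx.
  by rewrite mulrC divfK // pnatr_eq0.
exists u; split.
- have k0 : sphere_size 0 = 1%N.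
    rewrite -(cards1 v0); apply: eq_card => x.
    by rewrite !inE (dist_eq0 e_conn) eq_sym.
  rewrite /u k0 divr1 /U (big_pred1 v0) // => x /=.
  by rewrite (dist_eq0 e_conn) eq_sym.
- move=> i iD; have ki : (sphere_size i)%:R != 0 :> F.
    by rewrite pnatr_eq0 -lt0n sphere_size_gt0.
  (* Multiplied by the sphere size, the claim becomes the relation between sphere sums, by
     [k_(i-1) b_(i-1) = k_i c_i] and [k_i b_i = k_(i+1) c_(i+1)]. *)
  apply: (mulfI ki); have := nbr_sum_sphere i; rewrite -!/(U _) (Uu i) (Uu i.+1).
  have := sphere_size_rec i => /(congr1 (fun n => n%:R : F)); rewrite !natrM => rec.
  have := abc_sum iD => /(congr1 (fun n => n%:R : F)); rewrite !natrD => <-.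
  have -> : (if i is i'.+1 then (b i')%:R * \sum_(x | dist v0 x == i') w x else 0)
      = (sphere_size i)%:R * (c i)%:R * u i.-1.
    case: i {iD ki rec} => [|i] /=; first by rewrite c_zero mulr0 mul0r.
    by rewrite -/(U i) Uu -!natrM -sphere_size_rec natrM mulrA [in LHS](mulrC (b i)%:R).
  move=> H.
  have {}H : theta * ((sphere_size i)%:R * u i) = (sphere_size i)%:R * (c i)%:R * u i.-1
     + (a i)%:R * ((sphere_size i)%:R * u i) + (sphere_size i)%:R * (b i)%:R * u i.+1.
    by rewrite H rec; ring.
  by apply/eqP; rewrite -subr_eq0; apply/eqP; ring: H.
- transitivity (\sum_(i < D.+1) U i); last by apply: eq_bigr.
  rewrite (partition_big (fun x => inord (dist v0 x) : 'I_D.+1) predT) //=.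
  apply: eq_bigr => i _; apply: eq_bigl => x.
  by rewrite -val_eqE /= inordK // ltnS dist_le_diameter.
Qed.
End StandardSequence.

(** * Eigenvalue bounds in the absence of a large pair *)

Section SpectralGap.
Hypothesis d_gt1 : 1 < D.
Local Notation k := (b 0).
Local Notation N := (pow_log D).
Local Notation A := (inv_eps_root D).
Hypothesis no_large_pair : forall i, i < D ->
  (b i * A ^ 3 < k) || (c i.+1 * A ^ 3 < k).

Lemma pow_log_gt0 : 0 < N.
Proof. by rewrite expn_gt0 d_gt0. Qed.

Lemma inv_eps_root_ge : 200 * D ^ 2 * (D * N) <= A.
Proof. by rewrite /inv_eps_root (expnSr D 2) !mulnA. Qed.

Lemma inv_eps_root_gt0 : 0 < A.
Proof.
by apply: leq_trans inv_eps_root_ge; have := pow_log_gt0; have := d_gt0; nia.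
Qed.

Lemma threshold : exists s, [/\ 0 < s <= D, forall i, i < s -> k <= b i * A,
  c s * A ^ 3 < k & b s * A < k].
Proof.
have degree_gt0 : 0 < k := b_gt0 d_gt0.
have ex : exists i, b i * A < k.
  by exists D; rewrite b_diameter mul0n.
have [s s_lt s_min] := ex_minnP ex.
have sD : s <= D by apply: s_min; rewrite b_diameter mul0n.
have s_gt0 : 0 < s.
  by rewrite lt0n; apply: contraTneq s_lt => ->; rewrite -leqNgt leq_pmulr ?inv_eps_root_gt0.
exists s; split; rewrite ?s_gt0 ?sD //.
  by move=> i i_lt; rewrite leqNgt; apply: contraTN i_lt => /s_min; rewrite -leqNgt.
(* By minimality of [s], [b s.-1] is not small, so in this pair it is [c s] that is small. *)
have := @no_large_pair s.-1 ltac:(lia); rewrite prednK // => /orP[|//].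
have : k <= b s.-1 * A.
  by rewrite leqNgt; apply/negP => /s_min; lia.
move=> h1; rewrite ltnNge (leq_trans h1) // leq_mul2l -{1}(expn1 A) leq_pexp2l ?orbT //.
exact: inv_eps_root_gt0.
Qed.

Section Threshold.
Local Open Scope ring_scope.
Variables (F : realFieldType) (s : nat).
Hypotheses (s_bound : (0 < s <= D)%N) (b_large : forall i, (i < s)%N -> (k <= b i * A)%N).
Hypotheses (cs_small : (c s * A ^ 3 < k)%N) (bs_small : (b s * A < k)%N).

Local Notation S := (k%:R * binv_sum F s).

Lemma degree_gt0 : 0 < k%:R :> F.
Proof. by rewrite ltr0n (b_gt0 d_gt0). Qed.

Lemma inv_eps_root_natr_gt0 : 0 < A%:R :> F.
Proof. by rewrite ltr0n inv_eps_root_gt0. Qed.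

Lemma c_small i : (i <= s)%N -> (c i * A ^ 3 < k)%N.
Proof.
move=> i_s; apply: leq_ltn_trans cs_small; rewrite leq_mul2r.
by rewrite c_le ?orbT //; lia.
Qed.

(** This is [tradeoff_b] at the middle of the geodesic. The cube in [c j.+1 * A ^ 3 < k <= b j * A]
    leaves [A ^ 2] to absorb [j.+1 ^ 2 * (4 s + 1)], so the right side is at most
    [b j / (4 s + 1)]. *)
Lemma b_growth j : (0 < j < s)%N ->
  4 * s%:R * (k%:R / (b j)%:R) <= (4 * s%:R + 1) *
   (\sum_(r < uphalf j.+1) k%:R / (b r)%:R
     + \sum_(r < j.+1 - uphalf j.+1) k%:R / (b r)%:R) :> F.
Proof.
move=> j_bd; have k_pos := degree_gt0; have A_pos := inv_eps_root_natr_gt0.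
have jD : (j < D)%N by lia.
have bj := b_large (i := j) ltac:(lia).
have cb l : (l < j)%N -> (c l.+1 <= b l)%N.
  move=> l_j; have h1 := @c_small l.+1 ltac:(lia); have h2 := b_large (i := l) ltac:(lia).
  rewrite -(leq_pmul2r inv_eps_root_gt0); apply: leq_trans h2; apply: leq_trans (ltnW h1).
  by rewrite leq_mul2l -{1}(expn1 A) leq_pexp2l ?orbT // inv_eps_root_gt0.
have := @tradeoff_b F (uphalf j.+1) j jD ltac:(lia) cb.
rewrite -!mulr_sumr -/(binv_sum F (uphalf j.+1)) -/(binv_sum F (j.+1 - uphalf j.+1)).
rewrite -mulrDr; move: (binv_sum F _ + binv_sum F _) => X H.
have B_pos : 0 < (b j)%:R :> F by rewrite ltr0n b_gt0.
have cA : (c j.+1)%:R * A%:R ^+ 2 <= (b j)%:R :> F.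
  rewrite -natrX -natrM ler_nat -(leq_pmul2r inv_eps_root_gt0) -mulnA -expnSr.
  by apply: leq_trans bj; apply: ltnW; apply: c_small; lia.
have sA : j.+1%:R ^+ 2 * (4 * s%:R + 1) <= A%:R ^+ 2 :> F.
  rewrite -!natrX -natrM natr1 -natrM ler_nat.
  have : (200 * D ^ 2 <= A)%N.
    by apply: leq_trans inv_eps_root_ge; rewrite leq_pmulr // muln_gt0 d_gt0 pow_log_gt0.
  by move: A => A' A_ge; rewrite [X in (_ <= X)%N]expnS expn1; apply: leq_mul; nia.
have s_ge : 0 <= 4 * s%:R + 1 :> F by rewrite addr_ge0 // mulr_ge0.
have H1 : j.+1%:R ^+ 2 * (c j.+1)%:R * (4 * s%:R + 1) <= (b j)%:R :> F.
  apply: le_trans cA; rewrite mulrAC [X in _ <= X]mulrC.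
  by rewrite ler_wpM2r.
have H2 : 4 * s%:R <= (4 * s%:R + 1) * ((b j)%:R * X).
  have := le_trans (ler_wpM2r s_ge H) H1; move: (4 * s%:R) => t.
  rewrite -{3}[(b j)%:R]mulr1 -mulrA ler_pM2l //; lra.
rewrite mulrA ler_pdivrMr //; have := ler_wpM2r (ltW k_pos) H2.
by move/le_trans; apply; rewrite le_eqVlt; apply/orP; left; apply/eqP; ring.
Qed.

Lemma binv_sum_bound : S <= (4 * s.*2.-1 * s ^ (trunc_log 2 D).-1)%:R.
Proof.
have k_pos := degree_gt0; rewrite /binv_sum mulr_sumr.
apply: (growth_bound (g := fun r => k%:R / (b r)%:R) _ _ b_growth) => //.
- by rewrite divff // gt_eqF.
- move=> r r_s; rewrite ler_pdivlMr ?mul1r ?ler_nat ?b_le_degree ?ltr0n ?b_gt0 //; lia.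
- by rewrite leqnn andbT; case/andP: s_bound.
(* With [p = (trunc_log 2 D).-1] the condition is [s <= 2 ^ (trunc_log 2 D).+1], which holds since
   [s <= D]. *)
- have log_gt0 : (0 < trunc_log 2 D)%N by rewrite trunc_log_gt0.
  by rewrite prednK //; have := trunc_log_ltn D (isT : 1 < 2)%N; lia.
Qed.

Lemma pow_logE : (D ^ 2 * D ^ (trunc_log 2 D).-1 = D * N)%N.
Proof.
rewrite /pow_log -expnD -expnS; congr (_ ^ _)%N.
by have : (0 < trunc_log 2 D)%N by [rewrite trunc_log_gt0]; lia.
Qed.

(** From [4 (2 s - 1) <= 3 D ^ 2], with equality at [s = D = 2]. *)
Lemma binv_sum_le : S <= (3 * (D * N))%:R.
Proof.
apply: le_trans binv_sum_bound _; rewrite ler_nat -pow_logE mulnA.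
by apply: leq_mul; [nia | case: (_.-1) => // p; rewrite leq_exp2r //; lia].
Qed.

(** From [4 s (D - s) <= D ^ 2]; bounding the two factors separately would cost another factor of
    order [D]. *)
Lemma binv_sum_le_mul : (D - s)%:R * S <= (2 * (D * N))%:R.
Proof.
apply: le_trans (ler_wpM2l (ler0n _ _) binv_sum_bound) _.
rewrite -natrM ler_nat -pow_logE !mulnA.
have := (nat_AGM2 (D - s) s).1; rewrite subnK; last by case/andP: s_bound.
by move=> AGM; apply: leq_mul; [nia | case: (_.-1) => // p; rewrite leq_exp2r //; lia].
Qed.

Lemma inv_eps_root_natr_ge : 800%:R * (D * N)%:R <= A%:R :> F.
Proof.
rewrite -natrM ler_nat; apply: leq_trans inv_eps_root_ge; rewrite leq_mul2r.
by apply/orP; right; nia.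
Qed.

(** The last term of [tradeoff_c] is at most [1 / 100], because [(b s + c s) * A <= 2 k],
    [S + 1 <= 4 D N] and [A >= 800 D N]. *)
Lemma c_next_large : (s < D)%N -> 99%:R / 100%:R <= (c s.+1)%:R * binv_sum F s.
Proof.
move=> sD; have k_pos := degree_gt0; have A_pos := inv_eps_root_natr_gt0.
have A_le := inv_eps_root_natr_ge.
have X_le : S <= 3 * (D * N)%:R by rewrite -natrM binv_sum_le.
have bcA : (b s + c s)%:R * A%:R <= 2 * k%:R :> F.
  rewrite -!natrM ler_nat mulnDl; have := bs_small.
  suff : (c s * A < k)%N by lia.
  apply: leq_ltn_trans cs_small; rewrite leq_mul2l -{1}(expn1 A) leq_pexp2l ?orbT //.
  exact: inv_eps_root_gt0.
have DN : 1 <= (D * N)%:R :> F by rewrite ler1n muln_gt0 d_gt0 pow_log_gt0.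
have X_ge : 0 <= S by rewrite mulr_ge0 // sumr_ge0 // => r _; rewrite invr_ge0.
have XE : binv_sum F s = S / k%:R by rewrite mulrAC divff ?mul1r // gt_eqF.
move: (tradeoff_c F sD); move: S XE X_le X_ge => X -> X_le X_ge.
move: (b s + c s)%:R A%:R (D * N)%:R k_pos A_le X_le DN bcA A_pos.
move: k%:R (c s.+1)%:R => k' C bc A' DN k_pos A_le X_le DN1 bcA A_pos.
have H1 : bc * (X + 1) <= k' / 100%:R.
  rewrite -(ler_pM2r A_pos); apply: (@le_trans _ _ (2 * k' * (X + 1))).
    by rewrite mulrAC ler_wpM2r // addr_ge0.
  have h : 2 * (X + 1) <= A' / 100%:R by lra.
  by have := ler_wpM2l (ltW k_pos) h; lra.
have H2 : bc * (X / k' + k'^-1) <= 100%:R^-1.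
  have -> : X / k' + k'^-1 = (X + 1) / k' by rewrite mulrDl mul1r.
  by rewrite mulrA ler_pdivrMr //; move: H1; lra.
by lra.
Qed.


Lemma sequence_positive (u : nat -> F) (theta : F) : 0 < u 0 ->
  (forall i, (i <= D)%N -> (b i)%:R * (u i - u i.+1)
     = (c i)%:R * (u i.-1 - u i) + (k%:R - theta) * u i) ->
  k%:R * (1 - (4 * (D * N)%:R)^-1) < theta ->
  forall i, (i <= D)%N -> 0 < u i.
Proof.
move=> u0 rec theta_gt.
have k_pos := degree_gt0; have A_pos := inv_eps_root_natr_gt0; have A_le := inv_eps_root_natr_ge.
have DN : 1 <= (D * N)%:R :> F by rewrite ler1n muln_gt0 d_gt0 pow_log_gt0.
have DN_pos := lt_le_trans ltr01 DN.
have bD : (b D)%:R = 0 :> F by rewrite b_diameter.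
have cA i : (i <= s)%N -> (c i)%:R <= k%:R / A%:R :> F.
  move=> i_s; rewrite ler_pdivlMr // -natrM ler_nat; apply: leq_trans (ltnW (c_small i_s)).
  by rewrite leq_mul2l -{1}(expn1 A) leq_pexp2l ?orbT // inv_eps_root_gt0.
have bA i : (s <= i <= D)%N -> (b i)%:R <= k%:R / A%:R :> F.
  case/andP=> s_i iD; rewrite ler_pdivlMr // -natrM ler_nat.
  apply: leq_trans (ltnW bs_small); rewrite leq_mul2r b_le ?orbT //.
(* Here [q = 1 / 4 + 1 / 800], from the assumed gap and from [k / A]. The factors 3 and 2 belong to
   [binv_sum_le] and [binv_sum_le_mul], and [100 / 99] inverts the constant of [c_next_large]. *)
have [q [q_ge q3 q2 rate]] : exists q : F, [/\ 0 <= q, q * 3 < 1,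
    q * (100%:R / 99%:R) * 2 < 1 & k%:R - theta + k%:R / A%:R <= k%:R * q / (D * N)%:R].
  exists (201%:R / 800%:R); split; [lra | lra | lra |].
  have : A%:R^-1 <= (800%:R * (D * N)%:R)^-1 :> F.
    by rewrite lef_pV2 ?posrE // mulr_gt0.
  move=> /(ler_wpM2l (ltW k_pos)); move: (k%:R / A%:R) theta_gt.
  rewrite !invfM; move: (D * N)%:R^-1 k%:R => x k' t; lra.
have binv_ge : 0 <= binv_sum F s by rewrite sumr_ge0 // => r _; rewrite invr_ge0.
have [k_le|lt_k] := leP k%:R theta.
  apply: (positive_above_degree rec) => // i iD.
  by rewrite ltr0n b_gt0 // ler0n.
apply: (@positive_below_degree _ _ _ _ _ _ _ rec bD s (k%:R / A%:R) (k%:R / A%:R)) => //.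
- by case/andP: s_bound.
- exact: ltW.
- move=> i i_s; have iD : (i < D)%N by case/andP: s_bound => _; exact: leq_trans.
  by rewrite ltr0n ler0n (b_gt0 iD) (cA _ (ltnW i_s)).
- rewrite -/(binv_sum F s).
  apply: (le_lt_trans (ler_wpM2r binv_ge rate)).
  rewrite mulrAC (ltr_pdivrMr _ _ DN_pos) mul1r.
  have := ler_wpM2l q_ge binv_sum_le; have := ltr_pM2r DN_pos (q * 3) 1.
  rewrite q3 mul1r (natrM _ 3) -/(binv_sum F s).
  by move: (D * N)%:R k%:R (binv_sum F s) => x k' X; lra.
- move=> i /andP[s_i iD]; have i_gt0 : (0 < i <= D)%N by rewrite iD (leq_ltn_trans _ s_i).
  by rewrite ltr0n ler0n (c_gt0 i_gt0) bA // iD ltnW.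
- have [sD|] := ltnP s D; last first.
    by rewrite -subn_eq0 => /eqP->; rewrite big_ord0 mulr0.
  have H1 := c_next_large sD; have H2 := binv_sum_le_mul.
  have c_pos : 0 < (c s.+1)%:R :> F by rewrite ltr0n c_gt0.
  have sum_le : \sum_(r < D - s) (c (D - r)%N)%:R^-1 <= (D - s)%:R * (c s.+1)%:R^-1 :> F.
    rewrite mulr_natl -[X in _ *+ X](card_ord (D - s)) -sumr_const; apply: ler_sum => r _.
    have s_r : (s < D - r)%N by rewrite ltn_subRL addnC -ltn_subRL ltn_ord.
    have r_pos : (0 < D - r <= D)%N by rewrite leq_subr (leq_ltn_trans _ s_r).
    have cr_pos : 0 < (c (D - r))%:R :> F by rewrite ltr0n c_gt0.
    by rewrite lef_pV2 ?posrE // ler_nat c_le // leq_subr.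
  have cinv : (c s.+1)%:R^-1 <= 100%:R / 99%:R * binv_sum F s.
    by rewrite -(ler_pM2l c_pos) divff ?gt_eqF // mulrCA; lra.
  have r_ge : 0 <= k%:R - theta + k%:R / A%:R.
    by rewrite addr_ge0 ?divr_ge0 // subr_ge0 ltW.
  apply: le_lt_trans (ler_wpM2l r_ge sum_le) _.
  apply: le_lt_trans (ler_wpM2l r_ge (ler_wpM2l (ler0n _ _) cinv)) _.
  have nn : 0 <= (D - s)%:R * (100%:R / 99%:R * binv_sum F s) by rewrite !mulr_ge0 // invr_ge0.
  apply: le_lt_trans (ler_wpM2r nn rate) _; rewrite mulrAC (ltr_pdivrMr _ _ DN_pos) mul1r.
  have qq_ge : 0 <= q * (100%:R / 99%:R) by rewrite mulr_ge0 // divr_ge0.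
  have := ler_wpM2l qq_ge H2; have := ltr_pM2r DN_pos (q * (100%:R / 99%:R) * 2) 1.
  rewrite q2 mul1r (natrM _ 2).
  by move: (D * N)%:R k%:R (binv_sum F s) (D - s)%:R (100%:R / 99%:R) => x k' X y p; lra.
Qed.

End Threshold.

Section Eigenvalue.
Local Open Scope ring_scope.
Variables (F : realFieldType) (w : T -> F) (theta : F).
Hypothesis eigen : forall x, \sum_(y | e x y) w y = theta * w x.
Hypotheses (w_v0 : 0 < w v0) (w_sum : \sum_x w x = 0).

Lemma eigenvalue_upper : theta <= k%:R * (1 - (4 * (D * N)%:R)^-1).
Proof.
rewrite leNgt; apply/negP => lt_theta.
have [u [u0 rec sumE]] := standard_sequence eigen.
have [s [s_bound b_large cs_small bs_small]] := threshold.
have u_gt0 := sequence_positive s_bound b_large cs_small bs_small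
  (etrans (congr1 _ u0) w_v0) rec lt_theta.
have : 0 < \sum_(i < D.+1) (sphere_size i)%:R * u i.
  rewrite big_ord_recl /= ltr_pwDl //.
    by rewrite mulr_gt0 ?u_gt0 // ltr0n sphere_size_gt0.
  by rewrite sumr_ge0 // => i _; rewrite mulr_ge0 // ltW // u_gt0.
by rewrite -sumE w_sum ltxx.
Qed.

Lemma eigenvalue_lower : - (k%:R * (1 - (4 * (D * N)%:R)^-1)) <= theta.
Proof.
rewrite leNgt; apply/negP => lt_theta.
have [u [u0 rec _]] := standard_sequence eigen.
have k_pos : 0 < k%:R :> F := degree_gt0 F.
have A_pos : 0 < A%:R :> F := inv_eps_root_natr_gt0 F.
(* This makes the bound at least [k / 2], as [no_very_negative] requires. *)
have DN : (4 * (D * N)%:R)^-1 <= 2^-1 :> F.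
  rewrite lef_pV2 ?posrE ?mulr_gt0 ?ltr0n ?muln_gt0 ?d_gt0 ?pow_log_gt0 //.
  by rewrite -natrM ler_nat; have := pow_log_gt0; have := d_gt0; nia.
apply: (no_very_negative rec) => //.
- by rewrite b_diameter.
- by rewrite c_zero.
- by have := ler_wpM2l (ltW k_pos) DN; lra.
- by rewrite u0 gt_eqF.
- move=> i iD; split=> //; rewrite -natrD ler_nat; have := abc_sum iD; lia.
- move=> i iD; rewrite -natrX ler_pdivlMr // -!natrM ler_nat.
  have A3 : (16 <= A ^ 3)%N.
    have : (200 <= A)%N.
      by apply: leq_trans inv_eps_root_ge; have := pow_log_gt0; have := d_gt0; nia.
    by move=> h; apply: (@leq_trans (200 ^ 3)%N) => //; rewrite leq_exp2r.
  have bk := b_le_degree (ltnW iD); have ck := c_le_degree iD.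
  (* The small factor absorbs 16 since [A ^ 3 >= 16], and the other factor is at most [k]. *)
  case/orP: (no_large_pair iD) => h.
    by have : (b i * 16 <= k)%N; nia.
  by have : (c i.+1 * 16 <= k)%N; nia.
Qed.
End Eigenvalue.
End SpectralGap.

End DistanceRegular.

(** * The spectrum of the adjacency matrix *)

Section LinearAlgebra.
Local Open Scope ring_scope.

Lemma char_poly_conj (R : comUnitRingType) n (P B : 'M[R]_n) : P \in unitmx ->
  char_poly (invmx P *m B *m P) = char_poly B.
Proof.
move=> uP; rewrite /char_poly.
have PVP : map_mx polyC (invmx P) *m map_mx polyC P = 1%:M.
  by rewrite -map_mxM mulVmx // map_mx1.
have -> : char_poly_mx (invmx P *m B *m P)
    = map_mx polyC (invmx P) *m char_poly_mx B *m map_mx polyC P.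
  rewrite /char_poly_mx !map_mxM mulmxBr mulmxBl; congr (_ - _).
  by rewrite scalar_mxC -mulmxA PVP mulmx1.
by rewrite !det_mulmx mulrC mulrA -det_mulmx -map_mxM mulmxV // map_mx1 det1 mul1r.
Qed.

(** This labels the sorted eigenvalues by distinct indices, so that equal eigenvalues still come
    with orthogonal eigenvectors. *)
Lemma perm_eq_map_ex (I T : eqType) (f : I -> T) (s : seq T) (t : seq I) :
  perm_eq s (map f t) -> exists2 t', perm_eq t' t & s = map f t'.
Proof.
case: t => [|i0 t]; first by move/perm_nilP->; exists [::].
set u := i0 :: t => /(perm_iotaP (f i0))[Is]; rewrite size_map => Is_perm ->.
exists (map (nth i0 u) Is).
  by rewrite -[X in perm_eq _ X](mkseq_nth i0 u) perm_map.
rewrite -map_comp; apply/eq_in_map => i; rewrite (perm_mem Is_perm) mem_iota add0n.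
by move=> /andP[_ i_lt]; apply: nth_map.
Qed.

End LinearAlgebra.

Section Adjacency.
Local Open Scope ring_scope.
Variables (T : finType) (e : rel T).
Hypothesis e_sym : symmetric e.

Local Notation A := (adjmx e).
Local Notation P := (spectralmx A).
Local Notation sp := (spectral_diag A).

Lemma adjmx_hermitian : A \is hermsymmx.
Proof.
apply: realsym_hermsym.
  apply/is_hermitianmxP; rewrite expr0 scale1r; apply/matrixP => i j.
  by rewrite !mxE e_sym.
by apply/mxOverP => i j; rewrite mxE realn.
Qed.

Lemma adjmx_spectral : A = invmx P *m diag_mx sp *m P.
Proof. exact/orthomx_spectralP/hermitian_normalmx/adjmx_hermitian. Qed.

Lemma spectral_diag_real i : sp 0 i \is Num.real.
Proof. by have /mxOverP := hermitian_spectral_diag_real adjmx_hermitian. Qed.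

Lemma spectrum_perm : perm_eq (spectrum e) [seq sp 0 i | i <- enum 'I_#|T|].
Proof.
apply: prod_XsubC_eq; rewrite big_map big_enum /=.
rewrite /spectrum; case: closed_field_poly_normal => s /= sE.
move: (sE); rewrite (monicP (char_poly_monic _)) scale1r => <-.
rewrite [in LHS]adjmx_spectral char_poly_conj ?spectral_unit //.
rewrite char_poly_trig ?diag_mx_is_trig //.
by apply: eq_bigr => i _; rewrite mxE eqxx mulr1n.
Qed.

Definition spectral_fun (i : 'I_#|T|) (x : T) : algC := P i (enum_rank x).

(** The rows of [P] are left eigenvectors, by [P A = diag P]; symmetry of [e] turns columns into
    neighbourhoods. *)
Lemma spectral_fun_eigen i x :
  \sum_(y | e x y) spectral_fun i y = sp 0 i * spectral_fun i x.
Proof.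
have PA : P *m A = diag_mx sp *m P.
  by rewrite {2}adjmx_spectral !mulmxA mulmxV ?spectral_unit // mul1mx.
move/matrixP/(_ i (enum_rank x)): PA; rewrite mul_diag_mx !mxE => <-.
rewrite [RHS](reindex enum_rank) /=; last exact/onW_bij/enum_rank_bij.
rewrite big_mkcond; apply: eq_bigr => y _; rewrite mxE !enum_rankK e_sym.
by case: (e _ _); rewrite ?mulr1 ?mulr0.
Qed.

Lemma spectral_fun_ortho i j :
  \sum_x spectral_fun i x * (spectral_fun j x)^* = (i == j)%:R.
Proof.
have /unitarymxP/matrixP/(_ i j) := spectral_unitarymx A; rewrite !mxE => <-.
rewrite [RHS](reindex enum_rank) /=; last exact/onW_bij/enum_rank_bij.
by apply: eq_bigr => y _; rewrite !mxE.
Qed.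

Lemma spectral_fun_neq0 i : exists x, spectral_fun i x != 0.
Proof.
apply/existsP; apply: contraT; rewrite negb_exists => /forallP w0.
have := spectral_fun_ortho i i; rewrite eqxx big1 => [/eqP|x _].
  by rewrite eq_sym oner_eq0.
by move: (w0 x); rewrite negbK => /eqP->; rewrite mul0r.
Qed.
End Adjacency.

(** * From eigenvalue bounds to the zero-weight spectral radius *)

Section SpectralRadius.
Local Open Scope ring_scope.
Variables (T : finType) (e : rel T) (a b c : nat -> nat).
Hypotheses (e_sym : symmetric e) (e_irr : irreflexive e) (e_conn : connected e).
Hypotheses (d_gt1 : (1 < diameter e)%N) (drg : distance_regular e a b c).
Local Notation D := (diameter e).
Local Notation k := (b 0%N).
Hypothesis no_large_pair : forall i, (i < D)%N ->
  (b i * inv_eps_root D ^ 3 < k)%N || (c i.+1 * inv_eps_root D ^ 3 < k)%N.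

Let d_gt0 : (0 < D)%N := ltnW d_gt1.
Local Notation bound F := (k%:R * (1 - (4 * (D * pow_log D)%:R)^-1) : F).

(** The sign arguments need a totally ordered field, so eigenfunctions over [algC] are replaced by
    real parts in [algR]. *)
Definition re_algR (z : algC) : algR := in_algR (Creal_Re z).

Lemma re_algR_sum (I : finType) (Q : pred I) (f : I -> algC) :
  re_algR (\sum_(i | Q i) f i) = \sum_(i | Q i) re_algR (f i).
Proof. by apply: val_inj; rewrite /= raddf_sum (raddf_sum algRval). Qed.

Lemma re_algR_mul (x : algR) z : re_algR (val x * z) = x * re_algR z.
Proof. by apply: val_inj; rewrite /= ReMl // algRvalP. Qed.

Lemma bound_algR : val (bound algR) = bound algC.
Proof.
by rewrite rmorphM rmorphB rmorph1 fmorphV rmorphM !rmorph_nat.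
Qed.

Section Eigenfunction.
Variables (w : T -> algC) (theta : algC) (v : T).
Hypotheses (theta_real : theta \is Num.real) (wv : w v != 0).
Hypothesis eigen : forall x, \sum_(y | e x y) w y = theta * w x.

(** Division by [w v] gives the value 1 at [v], so taking real parts cannot kill the function. *)
Let w' x := re_algR (w x / w v).

Let eigen' x : \sum_(y | e x y) w' y = in_algR theta_real * w' x.
Proof.
by rewrite -re_algR_sum -re_algR_mul /= mulrA -eigen mulr_suml.
Qed.

Let w'v : 0 < w' v.
Proof.
rewrite /w' divff //; suff -> : re_algR 1 = 1 by exact: ltr01.
by apply: val_inj; apply/Creal_ReP; rewrite real1.
Qed.

Lemma algC_eigenvalue_lower : - bound algC <= theta.
Proof.
have := eigenvalue_lower e_sym e_irr e_conn d_gt0 drg d_gt1 no_large_pair eigen' w'v.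
by rewrite -bound_algR -rmorphN.
Qed.

Lemma algC_eigenvalue_upper : \sum_x w x = 0 -> theta <= bound algC.
Proof.
move=> w0; rewrite -bound_algR.
apply: (eigenvalue_upper e_sym e_irr e_conn d_gt0 drg d_gt1 no_large_pair eigen' w'v).
rewrite -re_algR_sum -mulr_suml w0 mul0r.
by apply: val_inj; apply/Creal_ReP; rewrite real0.
Qed.
End Eigenfunction.

Lemma eigen_sum (w : T -> algC) theta :
  (forall x, \sum_(y | e x y) w y = theta * w x) ->
  theta * \sum_x w x = k%:R * \sum_x w x.
Proof.
move=> eigen; rewrite !mulr_sumr; under eq_bigr do rewrite -eigen.
rewrite (exchange_big_dep predT) //=; apply: eq_bigr => y _.
under eq_bigl do rewrite e_sym.
by rewrite sumr_const -cardsE (degree e_irr e_conn d_gt0 drg) mulr_natl.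
Qed.

(** The upper bound excludes sum zero, so [theta = k] by [eigen_sum]. Then [w] minus its mean has
    sum zero and the same eigenvalue, so it must vanish. *)
Lemma large_eigenfunction_const (w : T -> algC) theta : theta \is Num.real ->
  (forall x, \sum_(y | e x y) w y = theta * w x) -> (exists v, w v != 0) ->
  ~~ (theta <= bound algC) -> forall x y, w x = w y.
Proof.
move=> theta_real eigen [v wv] theta_gt.
have w_sum : \sum_x w x != 0.
  by apply: contraNneq theta_gt; exact: (algC_eigenvalue_upper theta_real wv eigen).
have theta_k : theta = k%:R by apply: (mulIf w_sum); exact: eigen_sum.
have n_neq0 : #|T|%:R != 0 :> algC.
  by rewrite pnatr_eq0 -lt0n; apply/card_gt0P; exists v.
pose m := (\sum_x w x) / #|T|%:R.
suff wm x : w x = m by move=> x y; rewrite !wm.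
apply/eqP; rewrite -subr_eq0; apply: contraNT theta_gt => wx.
apply: (@algC_eigenvalue_upper (fun y => w y - m) theta x) => //.
  move=> y; rewrite sumrB eigen sumr_const -cardsE (degree e_irr e_conn d_gt0 drg).
  by rewrite mulrBr theta_k !mulr_natl.
by rewrite sumrB sumr_const -mulr_natr divfK // subrr.
Qed.

(** If the eigenvalue at [j] exceeded the bound, so would the one at [i]; both eigenfunctions would
    be nonzero constants, against orthogonality. *)
Lemma second_eigenvalue_bound i j : i != j ->
  spectral_diag (adjmx e) 0 j <= spectral_diag (adjmx e) 0 i ->
  `|spectral_diag (adjmx e) 0 j| <= bound algC.
Proof.
set sp := spectral_diag _ => ij sp_le.
have [v wv] := spectral_fun_neq0 e j.
have spR l : sp 0 l \is Num.real by exact: spectral_diag_real.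
rewrite real_ler_norml // (algC_eigenvalue_lower (spR j) wv) /=; last exact: spectral_fun_eigen.
apply: contraT => gt_j.
have gt_i : ~~ (sp 0 i <= bound algC) by apply: contraNN gt_j; exact: le_trans.
have const l := @large_eigenfunction_const (spectral_fun e l) _ (spR l)
  (spectral_fun_eigen e_sym l) (spectral_fun_neq0 e l).
have [v' wv'] := spectral_fun_neq0 e i.
have := spectral_fun_ortho e i j; rewrite (negbTE ij).
rewrite (eq_bigr (fun=> spectral_fun e i v' * (spectral_fun e j v)^*)); last first.
  by move=> x _; rewrite (const i gt_i x v') (const j gt_j x v).
rewrite sumr_const => /eqP; rewrite mulrn_eq0 mulf_eq0 conjC_eq0 (negbTE wv) (negbTE wv') !orbF.
by rewrite (_ : (_ == _) = false) //; apply/negbTE; rewrite -lt0n; apply/card_gt0P; exists v.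
Qed.

Lemma zw_spectral_radius_le : zw_spectral_radius e <= bound algC.
Proof.
(* Needed because the maximum starts from the default value 0. *)
have bound_ge0 : 0 <= bound algC.
  have DN : (0 < D * pow_log D)%N by rewrite muln_gt0 d_gt0 expn_gt0 d_gt0.
  rewrite mulr_ge0 // subr_ge0 invf_le1 ?mulr_gt0 ?ltr0n // -natrM ler1n.
  by rewrite muln_gt0.
rewrite /zw_spectral_radius.
set leT := fun x y : algC => y <= x.
have [Is Is_perm sortE] : exists2 Is, perm_eq Is (enum 'I_#|T|) &
    sort leT (spectrum e) = [seq spectral_diag (adjmx e) 0 i | i <- Is].
  by apply: perm_eq_map_ex; rewrite perm_sort spectrum_perm.
have Is_uniq : uniq Is by rewrite (perm_uniq Is_perm) enum_uniq.
(* The order of [algC] is only partial; sorting works because the eigenvalues are real. *)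
have srt : sorted leT (sort leT (spectrum e)).
  apply: (@sort_sorted_in _ Num.real) => [x y xR yR|].
    exact: real_leVge.
  rewrite (perm_all _ (spectrum_perm e_sym)); apply/allP => x /mapP[i _ ->].
  exact: spectral_diag_real.
(* The head [i] indexes the largest eigenvalue, which [behead] drops; it differs from every
   remaining index. *)
rewrite sortE in srt *; case: Is Is_uniq srt {Is_perm sortE} => [|i Is] /=.
  by rewrite big_nil.
move=> /andP[i_notin _]; rewrite path_sortedE; last first.
  by move=> x y z; rewrite /leT => xy yz; apply: le_trans yz xy.
move=> /andP[/allP le_i _]; rewrite big_map.
rewrite big_seq; apply: (big_ind (fun x => x <= bound algC)) => //.
  by move=> x y x_le y_le; rewrite /Num.max; case: ifP.
move=> j j_in; apply: (@second_eigenvalue_bound i).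
  by apply: contraNneq i_notin => ->.
by apply: le_i; apply: map_f.
Qed.
End SpectralRadius.

(** * Real constants *)

Section Constants.
Local Open Scope R_scope.

Lemma INR_muln m n : INR (m * n)%N = INR m * INR n.
Proof. exact: mult_INR. Qed.

Lemma INR_expn m n : INR (m ^ n)%N = INR m ^ n.
Proof. by elim: n => [|n IH]; rewrite ?expnS ?INR_muln ?IH. Qed.

Lemma INR_leq m n : (m <= n)%N -> INR m <= INR n.
Proof. by move/ssrnat.leP/le_INR. Qed.

Lemma frac_le n D k m : 0 < D -> 0 < m -> n * m <= k * (m - 1) * D ->
  n / D <= k * (1 - / m).
Proof.
move=> D_gt m_gt h; have Dm_gt := Rmult_lt_0_compat _ _ D_gt m_gt.
apply: (Rmult_le_reg_r _ _ _ Dm_gt).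
have ED : n * (/ D * D) * m = n * m by rewrite Rinv_l ?Rmult_1_r; Lra.lra.
have Em : k * D * (/ m * m) = k * D by rewrite Rinv_l ?Rmult_1_r; Lra.lra.
by rewrite /Rdiv; Lra.lra.
Qed.

Variable d : nat.
Hypothesis d_gt1 : (1 < d)%N.

Let d_ge2 : 2 <= INR d.
Proof. by have := INR_leq d_gt1; rewrite /=; Lra.lra. Qed.

Lemma pow_log_le : INR (pow_log d) <= Rpower (INR d) (log2 (INR d)).
Proof.
have ln2 : 0 < ln 2 by rewrite -ln_1; apply: ln_increasing; Lra.lra.
rewrite INR_expn -Rpower_pow; last by Lra.lra.
apply: Rle_Rpower; first by Lra.lra.
apply: (Rmult_le_reg_r (ln 2)) => //; rewrite /log2 /Rdiv Rmult_assoc Rinv_l; last by Lra.lra.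
rewrite Rmult_1_r -ln_pow; last by Lra.lra.
have le_d : 2 ^ trunc_log 2 d <= INR d.
  have := @INR_leq (2 ^ trunc_log 2 d) d; rewrite INR_expn; apply.
  by apply: trunc_logP => //; lia.
case: (Rle_lt_or_eq_dec _ _ le_d) => [lt_d|->]; last exact: Rle_refl.
by apply/Rlt_le/ln_increasing => //; apply: pow_lt; Lra.lra.
Qed.

Let N_ge1 : 1 <= INR (pow_log d).
Proof. by apply: (INR_leq (m := 1)); rewrite expn_gt0; lia. Qed.

Lemma eta_const_le : eta_const d <= / INR (4 * (d * pow_log d)).
Proof.
rewrite /eta_const Rpower_Ropp Rpower_plus Rpower_1; last by Lra.lra.
have E4 : INR 4 = 4 by rewrite /=; Lra.lra.
rewrite /Rdiv Rmult_1_l -Rinv_mult 2!INR_muln E4.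
have pl := pow_log_le; apply: Rinv_le_contravar.
  by apply: Rmult_lt_0_compat; [Lra.lra | apply: Rmult_lt_0_compat; Lra.lra].
apply: Rmult_le_compat_l; first by Lra.lra.
by apply: Rmult_le_compat_l; Lra.lra.
Qed.

(** The constant is [X ^ -(d + 1)] for some [X >= inv_eps_root d >= 1], and [d + 1 >= 3]. *)
Lemma eps_const_le : eps_const d <= / INR (inv_eps_root d ^ 3).
Proof.
set X := 200 * Rpower (INR d) (log2 (INR d) + 3).
have AX : INR (inv_eps_root d) <= X.
  rewrite /inv_eps_root 2!INR_muln INR_expn /X Rpower_plus.
  have -> : INR 200 = 200 by rewrite INR_IZR_INZ.
  have -> : Rpower (INR d) 3 = INR d ^ 3.
    by rewrite -Rpower_pow; [congr Rpower; rewrite /=; Lra.lra | Lra.lra].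
  rewrite Rmult_assoc [_ * INR d ^ 3]Rmult_comm; apply: Rmult_le_compat_l; first by Lra.lra.
  apply: Rmult_le_compat_l pow_log_le; apply: pow_le; Lra.lra.
have A_ge1 : 1 <= INR (inv_eps_root d).
  by apply: (INR_leq (m := 1)); rewrite !muln_gt0 !expn_gt0; lia.
have -> : eps_const d = / Rpower X (INR d.+1).
  rewrite /eps_const !Rpower_Ropp -Rinv_mult; congr Rinv.
  rewrite /X -Rpower_mult_distr; [|Lra.lra|exact: exp_pos].
  by rewrite Rpower_mult; congr (_ * Rpower _ _); rewrite Rmult_comm.
apply: Rinv_le_contravar; first by rewrite INR_expn; apply: pow_lt; Lra.lra.
apply: (Rle_trans _ (Rpower X 3)); last first.
  apply: Rle_Rpower; first by Lra.lra.
  by rewrite S_INR; Lra.lra.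
have -> : Rpower X 3 = X ^ 3.
  by rewrite -Rpower_pow; [congr Rpower; rewrite /=; Lra.lra | Lra.lra].
by rewrite INR_expn; apply: pow_incr; Lra.lra.
Qed.

Lemma eps_const_gt0 : 0 < eps_const d.
Proof. by apply: Rmult_lt_0_compat; exact: exp_pos. Qed.

Lemma eta_const_gt0 : 0 < eta_const d.
Proof. by apply: Rmult_lt_0_compat; [Lra.lra | exact: exp_pos]. Qed.

Lemma eps_const_mul_le k n : (k <= n * inv_eps_root d ^ 3)%N ->
  eps_const d * INR k <= INR n.
Proof.
move=> /INR_leq; rewrite INR_muln => k_le.
have A_gt : 0 < INR (inv_eps_root d ^ 3).
  by apply: lt_0_INR; apply/ssrnat.ltP; rewrite expn_gt0 !muln_gt0 !expn_gt0; lia.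
have := Rmult_le_compat_r _ _ _ (pos_INR k) eps_const_le => h.
apply: (Rle_trans _ _ _ h); apply: (Rmult_le_reg_l _ _ _ A_gt).
by rewrite -Rmult_assoc Rinv_r ?Rmult_1_l; Lra.lra.
Qed.
End Constants.


(** * Comparison of algebraic and real numbers through rational cuts *)

Lemma int2ZE : int2Z =1 ssrZ.Z_of_int.
Proof. by case=> n //=; rewrite addn1. Qed.

(** The bound on [x] is rational, so clearing denominators gives an inequality between integers,
    which can be read in [R]. *)
Lemma leCR_of_le (x : algC) (k m : nat) (y : R) : (0 < m)%N ->
  (x <= k%:R * (1 - m%:R^-1) :> algC)%R ->
  Rle (Rmult (INR k) (Rminus 1 (Rinv (INR m)))) y -> leCR x y.
Proof.
move=> m_gt0 x_le y_ge q q_le; apply: Rle_trans y_ge.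
have : (ratr q <= ratr (k%:R * (1 - m%:R^-1)) :> algC)%R.
  apply: le_trans q_le (le_trans x_le _).
  by rewrite rmorphM rmorphB rmorph1 fmorphV !rmorph_nat.
rewrite ler_rat => {x_le} {}q_le.
have num_le : (numq q * m%:Z <= k%:Z * (m%:Z - 1) * denq q)%R.
  rewrite -(ler_int rat) !rmorphM rmorphB /= rmorph1 -!pmulrn.
  have d_gt : (0 < (denq q)%:~R :> rat)%R by rewrite ltr0z denq_gt0.
  have m_gt : (0 < m%:R :> rat)%R by rewrite ltr0n.
  rewrite numqE mulrAC ler_pM2r //.
  have := ler_wpM2r (ltW m_gt) q_le; move/le_trans; apply.
  by rewrite -mulrA mulrBl mul1r mulVf // gt_eqF.
have den_gt := denq_gt0 q.
have {}num_le : Z.le (Z.mul (int2Z (numq q)) (Z.of_nat m))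
    (Z.mul (Z.mul (Z.of_nat k) (Z.sub (Z.of_nat m) 1)) (int2Z (denq q))).
  by rewrite !int2ZE; lia.
have {}den_gt : Z.lt 0 (int2Z (denq q)) by rewrite int2ZE; lia.
move/IZR_le: num_le; move/IZR_lt: den_gt.
rewrite !mult_IZR minus_IZR -!INR_IZR_INZ => den_gt num_le.
by apply: frac_le => //; apply/lt_0_INR/ssrnat.ltP.
Qed.

Theorem theorem3 (d : nat) : (2 <= d)%N ->
  Rlt 0 (eps_const d) /\ Rlt 0 (eta_const d) /\
  forall (T : finType) (e : rel T) (a b c : nat -> nat),
    symmetric e -> irreflexive e -> connected e ->
    diameter e = d -> distance_regular e a b c ->
    let k := b 0%N in
    (exists i : nat, (i < d)%N /\
        Rle (Rmult (eps_const d) (INR k)) (INR (b i)) /\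
        Rle (Rmult (eps_const d) (INR k)) (INR (c i.+1))) \/
    leCR (zw_spectral_radius e) (Rmult (INR k) (Rminus 1 (eta_const d))).
Proof.
move=> d_gt1; split; first exact: eps_const_gt0.
split; first exact: eta_const_gt0.
move=> T e a b c e_sym e_irr e_conn dE drg k.
pose A3 := inv_eps_root d ^ 3.
(* The alternative is decided with the integer [A3], whose inverse is at least [eps_const d]. *)
case: (boolP [exists i : 'I_d, (k <= b i * A3) && (k <= c i.+1 * A3)]).
  move=> /existsP[i /andP[b_ge c_ge]]; left; exists i.
  by split=> //; split; apply: eps_const_mul_le.
rewrite negb_exists => /forallP no_pair; right.
apply: (@leCR_of_le _ k (4 * (d * pow_log d))).
- by rewrite !muln_gt0 expn_gt0; lia.
- rewrite natrM -dE; apply: (zw_spectral_radius_le e_sym e_irr e_conn _ drg).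
    by rewrite dE.
  move=> i; rewrite dE => i_lt; have := no_pair (Ordinal i_lt).
  by rewrite negb_and -!ltnNge.
- apply: Rmult_le_compat_l; first exact: pos_INR.
  by apply: Rplus_le_compat_l; apply: Ropp_le_contravar; exact: eta_const_le.
Qed.
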